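(* Every embedding of $K_{3,3,1}$ in $\mathbb{R}^3$ contains a link consisting of a 3-cycle linked with a 4-cycle. Moreover, $K_{3,3,1}$ can be embedded in $\mathbb{R}^3$ with exactly one link (so $mnl(K_{3,3,1}) = 1$).
   Context: $K_{n_1,\dots,n_k}$ denotes the complete $k$-partite graph with parts of sizes $n_1,\dots,n_k$. An embedding of a finite graph $G$ means a tame embedding of $G$ in $\mathbb{R}^3$. A link in an embedding is an unordered pair of vertex-disjoint (simple closed) cycles of $G$ whose images form a non-trivial (non-split) two-component link (no three pairwise disjoint cycles exist in the graph considered here); links are counted as pairs of cycles. $mnl(G)$ is the minimal number of links in any embedding of $G$ in $\mathbb{R}^3$. *)

(* Defs.v *)
From HB Require Import structures.
From mathcomp Require Import all_boot all_order all_algebra.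
From mathcomp Require Import all_classical all_reals all_analysis.
Import Order.TTheory GRing.Theory Num.Theory.
Import numFieldNormedType.Exports.
Set Implicit Arguments.
Unset Strict Implicit.
Unset Printing Implicit Defensive.

Local Open Scope set_scope.

Record sgraph := SGraph {
  vertex :> finType;
  adj : rel vertex;
  adj_sym : symmetric adj;
  adj_irrefl : irreflexive adj }.

Section CompleteMultipartite.
Variable ns : seq nat.

(* (i, j) is the j-th vertex of the i-th part, which has size nth 0 ns i *)
Definition multipartite_vertex : finType :=
  {i : 'I_(size ns) & 'I_(nth 0%N ns i)}.

Definition multipartite_adj : rel multipartite_vertex :=
  fun u v => tag u != tag v.

Lemma multipartite_adj_sym : symmetric multipartite_adj.
Proof. by move=> u v; rewrite /multipartite_adj eq_sym. Qed.

Lemma multipartite_adj_irrefl : irreflexive multipartite_adj.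
Proof. by move=> u; rewrite /multipartite_adj eqxx. Qed.

Definition complete_multipartite : sgraph :=
  SGraph multipartite_adj_sym multipartite_adj_irrefl.

End CompleteMultipartite.

Section Cycles.
Variable G : sgraph.
Implicit Types C : {set {set G}}.

Definition edges : {set {set G}} :=
  [set [set u.1; u.2] | u in [set u : G * G | adj u.1 u.2]].

(* The singletons account for isolated vertices. *)
Definition simplices : {set {set G}} := edges :|: [set [set x] | x : G].

(* A cycle of G is the edge set of a closed path of length at least 3 without
   repeated vertices; thus two closed paths that differ only by their starting
   point or their direction give the same cycle. The length of a cycle C is
   #|C| and its vertex set is finset.cover C. *)
Definition cycle_edges (s : seq G) : {set {set G}} :=
  [set [set x; next s x] | x in s].

Definition is_cycle C : Prop :=
  exists s : seq G, [/\ ucycle (@adj G) s, (3 <= size s)%N & C = cycle_edges s].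

Definition vertex_disjoint C1 C2 : bool :=
  [disjoint finset.cover C1 & finset.cover C2].

End Cycles.

Local Close Scope set_scope.
Local Open Scope classical_set_scope.
Local Open Scope ring_scope.

Section Realization.
Variables (R : realType) (G : sgraph).

(* Points are given by barycentric coordinates on the vertices: X is a set of
   simplices (each a set of vertices), and a point belongs to the realization
   of X when its coordinates are supported in some member of X. *)
Definition realization (X : {set {set G}}) : set {ptws G -> R} :=
  [set p | [/\ forall v, 0 <= p v, \sum_v p v = 1
             & exists2 e, e \in X & forall v, v \notin e -> p v = 0]].

Definition graph_space : set {ptws G -> R} := realization (simplices G).

End Realization.

Arguments realization R {G} X _.
Arguments graph_space R G _ : clear implicits.

Section Space.
Variable R : realType.
Local Notation R3 := 'rV[R]_3.
Implicit Types (A B S : set R3).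

Definition homeomorphism_R3 (h : R3 -> R3) : Prop :=
  continuous h /\
  exists g : R3 -> R3, [/\ continuous g, cancel h g & cancel g h].

Definition segment (a b : R3) : set R3 :=
  [set (1 - t) *: a + t *: b | t in `[0, 1]%classic].

Definition polygonal A : Prop :=
  exists s : seq (R3 * R3), A = \bigcup_(ab in [set` s]) segment ab.1 ab.2.

Definition unit_sphere : set R3 := [set x | \sum_i x 0 i ^+ 2 = 1].

Definition tame_sphere S : Prop :=
  exists2 h : R3 -> R3, homeomorphism_R3 h & S = h @` unit_sphere.

(* A and B are separated by a (tamely embedded) 2-sphere S that misses both of
   them: no point of A lies in the same component of the complement of S as a
   point of B. *)
Definition split_link A B : Prop :=
  exists S, [/\ tame_sphere S, S `&` (A `|` B) = set0
    & forall x y, A x -> B y -> ~ connected_component (~` S) x y].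

End Space.

Section Embeddings.
Variables (R : realType) (G : sgraph).
Implicit Types (f : {ptws G -> R} -> 'rV[R]_3) (C : {set {set G}}).

(* The graph is compact, so a continuous injective map is a homeomorphism onto
   its image. Only the values of f on graph_space are meaningful. *)
Definition graph_embedding f : Prop :=
  {within graph_space R G, continuous f} /\
  {in graph_space R G &, injective f}.

(* The images of the edges are arcs, so asking that h carry each of them to a
   finite union of segments says that it carries them to polygonal arcs. *)
Definition tame_embedding f : Prop :=
  graph_embedding f /\
  exists2 h : 'rV[R]_3 -> 'rV[R]_3, homeomorphism_R3 h &
    forall e, e \in edges G ->
      polygonal (h @` (f @` realization R [set e]%SET)).

Definition is_link f C1 C2 : Prop :=
  [/\ is_cycle C1, is_cycle C2, vertex_disjoint C1 C2 &
      ~ split_link (f @` realization R C1) (f @` realization R C2)].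

Definition links f : {set {set {set {set G}}}} :=
  [set P : {set {set {set G}}} | `[< exists C1 C2,
    P = [set C1; C2]%SET /\ is_link f C1 C2 >]]%SET.

(* The unique minimum of the number of links over all tame embeddings. The
   default 0 of xget is never used, as every finite graph has such an
   embedding. *)
Definition mnl : nat :=
  xget 0%N [set n | (exists2 f, tame_embedding f & #|links f| = n) /\
                    (forall f, tame_embedding f -> (n <= #|links f|)%N)].

End Embeddings.

Definition K331 : sgraph := complete_multipartite [:: 3; 3; 1]%N.

(* Main.v *)
Require Import Defs.
From HB Require Import structures.
From mathcomp Require Import all_boot all_order all_algebra.
From mathcomp Require Import all_classical all_reals all_analysis.
From mathcomp Require Import ring lra.

(** For the lower bound, give two disjoint closed polygons A and B in general
    position the linking number modulo 2: the parity of the number of times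
    that B pierces the cone over A from a point e ([crossing]).  Two facts
    about six points of space carry its theory.  A segment enters and leaves a
    tetrahedron, and the intersection of two triangles is a segment or empty
    ([pierced_tetra], [pierced_triangles]); both are instances of one parity
    lemma on a configuration of six vectors of the plane ([even_radon]).  The
    first makes [crossing] independent of e and invariant under polygonal
    homotopies of A away from B ([crossing_apex], [crossing_homotopy]); the
    second makes it symmetric ([crossingC]).

    Take an embedding of K_{3,3,1}, with apex C and parts A, B.  A triangle
    C a b misses exactly the quadrilateral of the edges i j with i <> a and
    j <> b, and the nine linking numbers of these pairs add up to 1
    ([odd_total_crossing]).  Indeed, in the sum over all pairs each edge C a
    faces each edge i j exactly twice, so that only the pairs of disjoint edges
    of K_{3,3} count.  What is left is the number, modulo 2, of crossings of
    disjoint edges of K_{3,3} seen from e, and it does not change when an edge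
    is replaced by another path with the same ends: the difference is a cycle,
    which meets the quadrilateral disjoint from it evenly, by the symmetry of
    the linking number.  Paths through the corners of a hexagon, where only the
    three long diagonals cross, give 1.

    It remains that split curves have linking number 0 ([split_unlinked]).  Of
    two curves separated by a tame sphere one lies in the ball; its contraction
    in the ball stays at a positive distance from the other one.  A fine
    polygonal approximation of the contraction ([null_crossing]) computes the
    linking number as that of a point.  Polygons are drawn on the given curves
    by joining nearby points ([connected_chain]) and moved into general
    position along small moment curves ([perturb]).  So one of the nine pairs
    is linked in every embedding ([K331_linked]).

    For the upper bound, seven points in general position define a
    straight-line embedding ([straight_tame]).  They are chosen such that for
    eight of the nine pairs an ellipsoid contains the corners of the triangle
    and leaves the quadrilateral outside ([K331_embedding_split]).  Two
    disjoint cycles of K_{3,3,1} always form one of the nine pairs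
    ([K331_disjoint_cycles]), so exactly one pair of cycles is linked. *)

Set Implicit Arguments.
Unset Strict Implicit.
Unset Printing Implicit Defensive.
Import Order.TTheory GRing.Theory Num.Theory.
Import numFieldNormedType.Exports.
Local Open Scope ring_scope.

(** * Signs of determinants and six points in space *)

(** The sign conditions below all ask that five signs agree. *)
Definition alike (a b c d e : bool) := [&& a == b, a == c, a == d & a == e].

(** All that the relation a b - c d + e f = 0 says about the signs of six
    nonzero numbers: if a b and e f have the same sign, then so has c d. *)
Definition plucker (a b c d e f : bool) :=
  ((a == b) == (e == f)) ==> ((c == d) == (a == b)).

Fixpoint all_bits n (P : seq bool -> bool) : bool :=
  if n is n'.+1 then
    all_bits n' (fun s => P (true :: s)) && all_bits n' (fun s => P (false :: s))
  else P [::].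

(** Statements on a bounded number of booleans are decided by one
    evaluation instead of a case analysis in the proof term. *)
Lemma all_bitsP n P : all_bits n P -> forall s, size s = n -> P s.
Proof.
elim: n P => [|n IH] P /=; first by move=> ? [].
by move=> /andP[Pt Pf] [|[] s] //= [ss]; [apply: (IH _ Pt)|apply: (IH _ Pf)].
Qed.

Definition even_extremes_test (s : seq bool) : bool :=
  if s is [:: b01; b02; b03; b04; b05; b12; b13; b14; b15; b23; b24; b25;
              b34; b35; b45] then
   [&& plucker b01 b23 b02 b13 b03 b12, plucker b01 b24 b02 b14 b04 b12,
       plucker b01 b25 b02 b15 b05 b12, plucker b01 b34 b03 b14 b04 b13,
       plucker b01 b35 b03 b15 b05 b13, plucker b01 b45 b04 b15 b05 b14,
       plucker b02 b34 b03 b24 b04 b23, plucker b02 b35 b03 b25 b05 b23,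
       plucker b02 b45 b04 b25 b05 b24, plucker b03 b45 b04 b35 b05 b34,
       plucker b12 b34 b13 b24 b14 b23, plucker b12 b35 b13 b25 b15 b23,
       plucker b12 b45 b14 b25 b15 b24, plucker b13 b45 b14 b35 b15 b34 &
       plucker b23 b45 b24 b35 b25 b34] ==>
   ~~ (alike b01 b02 b03 b04 b05 (+) alike (~~ b01) b12 b13 b14 b15 (+)
       alike (~~ b02) (~~ b12) b23 b24 b25 (+)
       alike (~~ b03) (~~ b13) (~~ b23) b34 b35 (+)
       alike (~~ b04) (~~ b14) (~~ b24) (~~ b34) b45 (+)
       alike (~~ b05) (~~ b15) (~~ b25) (~~ b35) (~~ b45))
  else true.

(** Read b_ij as the sign of det (g_i, g_j) for six vectors of the plane,
    no two of them parallel; the fifteen hypotheses are the three-term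
    relations.  Row i is constant when all other vectors lie on one side of
    the line of g_i.  In that case the vectors are linearly ordered by their
    angle with g_i, which comes first, and the last one is the only other
    vector with this property.  Hence there are zero or two constant rows. *)
Lemma even_extremes s : even_extremes_test s.
Proof.
have [|] := eqVneq (size s) 15.
  by apply: all_bitsP; vm_compute.
by do 16?[case: s => [|? s] //].
Qed.

Section Volumes. Variable R : realFieldType.
Implicit Types x y z w : 'rV[R]_3.
Definition det3 (u v w : 'rV[R]_3) : R :=
  u 0 0 * (v 0 1 * w 0 2 - v 0 2 * w 0 1)
  - u 0 1 * (v 0 0 * w 0 2 - v 0 2 * w 0 0)
  + u 0 2 * (v 0 0 * w 0 1 - v 0 1 * w 0 0).
Definition vol x y z w : R := det3 (y - x) (z - x) (w - x).
Definition pos x y z w : bool := 0 < vol x y z w.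

Lemma plucker_sign (a b c d e f : R) : a * b - c * d + e * f = 0 ->
  a != 0 -> b != 0 -> c != 0 -> d != 0 -> e != 0 -> f != 0 ->
  plucker (0 < a) (0 < b) (0 < c) (0 < d) (0 < e) (0 < f).
Proof.
have sg (x y : R) : x != 0 -> y != 0 -> ((0 < x) == (0 < y)) = (0 < x * y).
  move=> x0 y0; case: (ltP 0 x) => hx; first by rewrite pmulr_rgt0.
  have x_lt0 : x < 0 by rewrite lt_neqAle x0.
  rewrite nmulr_rgt0 //.
  by case: ltgtP y0.
move=> eq0 a0 b0 c0 d0 e0 f0; rewrite /plucker (sg a b) // (sg e f) // (sg c d) //.
apply/implyP => /eqP h; apply/eqP.
have ab0 : a * b != 0 by rewrite mulf_neq0.
have ef0 : e * f != 0 by rewrite mulf_neq0.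
have cd0 : c * d != 0 by rewrite mulf_neq0.
move: h ab0 ef0 cd0 eq0; move: (a * b) (e * f) (c * d) => x y z.
case: (ltgtP 0 x) => hx; case: (ltgtP 0 y) => hy; case: (ltgtP 0 z) => hz //= h ab0 ef0 cd0 eq0;
  solve [by [] | lra | by rewrite -hx eqxx in ab0 | by rewrite -hy eqxx in ef0 | by rewrite -hz eqxx in cd0].
Qed.

(** The affine dependence of five points has as coefficients, up to
    alternating signs, the volumes of the five tetrahedra that they span.  The
    triangle x y z and the segment c d have a common point when this dependence
    is positive on one of them and negative on the other. *)
Definition pierced x y z c d :=
  alike (pos y z c d) (~~ pos x z c d) (pos x y c d) (pos x y z d) (~~ pos x y z c).

Definition inside x y z w c :=
  alike (pos y z w c) (~~ pos x z w c) (pos x y w c) (~~ pos x y z c) (~~ pos x y z w).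

Definition generic6 x0 x1 x2 x3 x4 x5 :=
  [/\ [/\ vol x0 x1 x2 x3 != 0, vol x0 x1 x2 x4 != 0, vol x0 x1 x2 x5 != 0,
       vol x0 x1 x3 x4 != 0 & vol x0 x1 x3 x5 != 0],
     [/\ vol x0 x1 x4 x5 != 0, vol x0 x2 x3 x4 != 0, vol x0 x2 x3 x5 != 0,
       vol x0 x2 x4 x5 != 0 & vol x0 x3 x4 x5 != 0] &
     [/\ vol x1 x2 x3 x4 != 0, vol x1 x2 x3 x5 != 0, vol x1 x2 x4 x5 != 0,
       vol x1 x3 x4 x5 != 0 & vol x2 x3 x4 x5 != 0]].

Ltac gp := apply: plucker_sign => //; rewrite /vol /det3 !mxE; ring.

(** The dependences of six points of space form a plane, and the
    dependence that avoids the i-th point is the i-th row of the six by six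
    matrix a of its two by two determinants: up to sign, a_ij is the volume of
    the other four points.  The Radon condition for a partition of the points
    other than i, given by n, is that row i is constant after the sign changes
    n.  So a partition of six points induces an even number of Radon partitions
    of five of them. *)
Lemma even_radon x0 x1 x2 x3 x4 x5 (n0 n1 n2 n3 n4 n5 : bool) :
  generic6 x0 x1 x2 x3 x4 x5 ->
  let a01 := pos x2 x3 x4 x5 (+) (~~ (n0 (+) n1)) in
  let a02 := pos x1 x3 x4 x5 (+) (n0 (+) n2) in
  let a03 := pos x1 x2 x4 x5 (+) (~~ (n0 (+) n3)) in
  let a04 := pos x1 x2 x3 x5 (+) (n0 (+) n4) in
  let a05 := pos x1 x2 x3 x4 (+) (~~ (n0 (+) n5)) in
  let a12 := pos x0 x3 x4 x5 (+) (~~ (n1 (+) n2)) in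
  let a13 := pos x0 x2 x4 x5 (+) (n1 (+) n3) in
  let a14 := pos x0 x2 x3 x5 (+) (~~ (n1 (+) n4)) in
  let a15 := pos x0 x2 x3 x4 (+) (n1 (+) n5) in
  let a23 := pos x0 x1 x4 x5 (+) (~~ (n2 (+) n3)) in
  let a24 := pos x0 x1 x3 x5 (+) (n2 (+) n4) in
  let a25 := pos x0 x1 x3 x4 (+) (~~ (n2 (+) n5)) in
  let a34 := pos x0 x1 x2 x5 (+) (~~ (n3 (+) n4)) in
  let a35 := pos x0 x1 x2 x4 (+) (n3 (+) n5) in
  let a45 := pos x0 x1 x2 x3 (+) (~~ (n4 (+) n5)) in
  alike a01 a02 a03 a04 a05 (+) alike (~~ a01) a12 a13 a14 a15 (+)
  alike (~~ a02) (~~ a12) a23 a24 a25 (+)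
  alike (~~ a03) (~~ a13) (~~ a23) a34 a35 (+)
  alike (~~ a04) (~~ a14) (~~ a24) (~~ a34) a45 (+)
  alike (~~ a05) (~~ a15) (~~ a25) (~~ a35) (~~ a45) = false.
Proof.
move=> [[h1 h2 h3 h4 h5] [h6 h7 h8 h9 h10] [h11 h12 h13 h14 h15]].
(* the sign changes cancel in each three-term relation *)
have twist (a b c d e f k : bool) (p q r s u v : bool) :
   plucker a b c d e f -> p (+) q = k -> r (+) s = k -> u (+) v = k ->
   plucker (a (+) p) (b (+) q) (c (+) r) (d (+) s) (e (+) u) (f (+) v).
  have addb_eq (x y z w : bool) : (x (+) z == y (+) w) = (x == y) (+) (z (+) w).
    by case: x y z w => [] [] [] [].
  rewrite /plucker (addb_eq a b) (addb_eq c d) (addb_eq e f) => + -> -> ->.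
  by case: (a == b) (e == f) (c == d) k => [] [] [] [].
move=> *; apply/negbTE.
apply: (implyP (even_extremes [:: _; _; _; _; _; _; _; _; _; _; _; _; _; _; _])).
repeat (apply/andP; split);
  (apply: twist; [gp|reflexivity| | ]).
all: by clear -n0 n1 n2 n3 n4 n5; case: n0 n1 n2 n3 n4 n5 => [] [] [] [] [] [].
Qed.

End Volumes.

Section SixPoints. Variable R : realFieldType.
Implicit Types x y z w : 'rV[R]_3.
Lemma alikeN a b c d e :
  alike (~~ a) b c d e = alike a (~~ b) (~~ c) (~~ d) (~~ e).
Proof. by case: a b c d e => [] [] [] [] []. Qed.

Lemma alike_rot a b c d e : alike a b c d e = alike d e a b c.
Proof. by case: a b c d e => [] [] [] [] []. Qed.

(** The partition of the six points into the tetrahedron and the segment: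
    the number of faces pierced by c d has the parity of the number of ends of
    c d in the tetrahedron. *)
Lemma pierced_tetra x y z w c d : generic6 x y z w c d ->
  pierced y z w c d (+) pierced x z w c d (+) pierced x y w c d (+) pierced x y z c d =
  inside x y z w c (+) inside x y z w d.
Proof.
move=> g; have := even_radon false false false false true true g.
rewrite /= !addbT !addbF ?alikeN ?negbK /pierced /inside => h.
have six (p q r s t o : bool) : p (+) q (+) r (+) s (+) t (+) o = false ->
  p (+) q (+) r (+) s = o (+) t by move: p q r s t o; do 6!case.
exact: six.
Qed.

Lemma pos_swap2 x y c d : pos c d x y = pos x y c d.
Proof. by congr (0 < _); rewrite /vol /det3 !mxE; ring. Qed.

Lemma pos_cycle x y z c : vol x y z c != 0 -> pos y z c x = ~~ pos x y z c.
Proof.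
rewrite /pos (_ : vol y z c x = - vol x y z c) ?oppr_gt0; first by case: ltgtP.
by rewrite /vol /det3 !mxE; ring.
Qed.

(** The partition into two triangles: their intersection is empty or a
    segment, and each end of this segment is the point where an edge of one
    triangle pierces the other one. *)
Lemma pierced_triangles x y z u v w : generic6 x y z u v w ->
  pierced x y z v w (+) pierced x y z u w (+) pierced x y z u v =
  pierced u v w y z (+) pierced u v w x z (+) pierced u v w x y.
Proof.
move=> g; have := even_radon false false false true true true g.
case: g => [[h1 h2 h3 h4 h5] [h6 h7 h8 h9 h10] [h11 h12 h13 h14 h15]].
rewrite /= !addbT !addbF ?alikeN ?negbK /pierced.
rewrite (pos_swap2 y z v w) (pos_swap2 y z u w) (pos_swap2 y z u v).
rewrite (pos_swap2 x z v w) (pos_swap2 x z u w) (pos_swap2 x z u v).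
rewrite (pos_swap2 x y v w) (pos_swap2 x y u w) (pos_swap2 x y u v).
rewrite !(pos_cycle (x := x)) ?(pos_cycle (x := y)) ?(pos_cycle (x := z)) // ?negbK.
have six (p q r s t o : bool) : p (+) q (+) r (+) s (+) t (+) o = false ->
  s (+) t (+) o = p (+) q (+) r by move: p q r s t o; do 6!case.
rewrite (alike_rot (pos y z v w) (~~ pos y z u w)).
rewrite (alike_rot (pos x z v w) (~~ pos x z u w)).
rewrite (alike_rot (pos x y v w) (~~ pos x y u w)).
rewrite ?alikeN ?negbK; exact: six.
Qed.

End SixPoints.

(** * Linking numbers modulo 2 of polygonal chains *)

Local Notation "\xor_ ( i <- r ) F" := (\big[addb/false]_(i <- r) F%B)
  (at level 41, F at level 41, i, r at level 50).

Section Chains. Variable R : realFieldType.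
Local Notation point := 'rV[R]_3.
Implicit Types (x y z w : point) (L : seq point) (A B : seq (point * point)).

Lemma pierced_xxz x z c d : pierced x x z c d = false.
Proof. by rewrite /pierced /alike; case: (pos x z c d). Qed.

Lemma pierced_xyy x y c d : pierced x y y c d = false.
Proof. by rewrite /pierced /alike; case: (pos y y c d) (pos x y c d) => [] []. Qed.

Lemma pierced_point x y z c : pierced x y z c c = false.
Proof.
by rewrite /pierced /alike; case: (pos x y z c) (pos y z c c) (_ == _) (_ == _) => [] [] [] []. Qed.

Lemma pierced_xyx x y c d : pierced x y x c d = false.
Proof.
rewrite /pierced /alike /pos.
have -> : vol x x c d = 0 by rewrite /vol /det3 !mxE; ring.
have -> : vol y x c d = - vol x y c d by rewrite /vol /det3 !mxE; ring.
rewrite oppr_gt0 ltxx /=; case: ltgtP => //=.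
Qed.

(** Exchanging y and z changes all five signs of the condition. *)
Lemma pierced_swap x y z c d : vol y z c d != 0 -> vol x y z c != 0 ->
  vol x y z d != 0 -> pierced x z y c d = pierced x y z c d.
Proof.
rewrite /pierced /pos => h1 h2 h3.
have -> : vol z y c d = - vol y z c d by rewrite /vol /det3 !mxE; ring.
have -> : vol x z y d = - vol x y z d by rewrite /vol /det3 !mxE; ring.
have -> : vol x z y c = - vol x y z c by rewrite /vol /det3 !mxE; ring.
have oppE (a : R) : a != 0 -> (0 < - a) = ~~ (0 < a) by rewrite oppr_gt0; case: ltgtP.
rewrite !oppE // alikeN !negbK.
move: (0 < _) (0 < _) (0 < _) (0 < _) (0 < _); do 5!case=> //.
Qed.

(** General position is required of distinct points only, so that chains may
    have repeated vertices and degenerate edges. *)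
Definition generic L := forall x y z w, {subset [:: x; y; z; w] <= L} ->
  uniq [:: x; y; z; w] -> vol x y z w != 0.

Lemma generic_generic6 L x0 x1 x2 x3 x4 x5 : generic L ->
  {subset [:: x0; x1; x2; x3; x4; x5] <= L} ->
  uniq [:: x0; x1; x2; x3; x4; x5] -> generic6 x0 x1 x2 x3 x4 x5.
Proof.
move=> gL sub; rewrite /= !inE !negb_or -!andbA.
case/and5P=> ? ? ? ? /and5P[? ? ? ?] /and5P[? ? ? ?] /and4P[? ? ? _].
have mem i : i \in [:: x0; x1; x2; x3; x4; x5] -> i \in L by apply: sub.
by split; split; apply: gL; rewrite /= ?inE ?negb_or;
  do ?[apply/andP; split=> //] => // i; rewrite !inE => /or4P[]/eqP->;
  apply: mem; rewrite !inE eqxx ?orbT.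
Qed.

Definition ends A : seq point := unzip1 A ++ unzip2 A.

(** The boundary of a chain modulo 2 is tested against functions on points:
    a sum of paths is closed when it passes an even number of times through the
    ends of its edges, whatever the order and the orientation of the edges. *)
Definition closed_chain A := forall phi : point -> bool,
  \xor_(s <- A) (phi s.1 (+) phi s.2) = false.

Definition piercings x y z B := \xor_(t <- B) pierced x y z t.1 t.2.

(** The intersection number modulo 2 of B with the cone from e over A.  For
    closed chains it is their linking number; for two edges it says whether
    the first one crosses over the second one, seen from e. *)
Definition crossing e A B := \xor_(s <- A) piercings e s.1 s.2 B.

Lemma ends1 A s : s \in A -> s.1 \in ends A.
Proof. by move=> sA; rewrite mem_cat map_f. Qed.

Lemma ends2 A s : s \in A -> s.2 \in ends A.
Proof. by move=> sA; rewrite mem_cat (map_f snd) ?orbT. Qed.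

Lemma piercings_swap L x y z B : generic L -> {subset [:: x, y, z & ends B] <= L} ->
  uniq [:: x; y; z] -> {in [:: x; y; z], forall u, u \notin ends B} ->
  piercings x z y B = piercings x y z B.
Proof.
move=> gL sub un dis; rewrite /piercings !big_seq; apply: eq_bigr => t tB.
have [<-|neq] := eqVneq t.1 t.2; first by rewrite !pierced_point.
have notB u v : u \in [:: x; y; z] -> v \in ends B -> u != v.
  by move=> /dis uB vB; apply: contra uB => /eqP->.
have [t1 t2] := (ends1 tB, ends2 tB).
move: un; rewrite /= !inE !negb_or !andbT => /andP[/andP[xy xz] yz].
have xN v : v \in ends B -> x != v by apply: notB; rewrite !inE eqxx.
have yN v : v \in ends B -> y != v by apply: notB; rewrite !inE eqxx orbT.
have zN v : v \in ends B -> z != v by apply: notB; rewrite !inE eqxx !orbT.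
by apply: pierced_swap; apply: gL; rewrite /= ?inE ?negb_or ?xy ?xz ?yz ?xN ?yN ?zN ?neq //
   => u; rewrite !inE => /or4P[]/eqP->; apply: sub; rewrite !inE ?eqxx ?orbT ?t1 ?t2 ?orbT.
Qed.

(** A closed chain enters a tetrahedron as often as it leaves it.  Degenerate
    tetrahedra are included, since a discrete homotopy may contain them. *)
Lemma piercings_tetra L x y z w B : generic L -> closed_chain B ->
  {subset [:: x, y, z, w & ends B] <= L} ->
  x \notin [:: y; z; w] ->
  {in [:: x; y; z; w], forall u, u \notin ends B} ->
  piercings y z w B = piercings x y z B (+) piercings x y w B (+) piercings x z w B.
Proof.
move=> gL cB sub xN dis.
have subL u : u \in [:: x, y, z, w & ends B] -> u \in L by apply: sub.
have piercings0 (F : point * point -> bool) : (forall t, F t = false) -> \xor_(t <- B) F t = false.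
  by move=> F0; rewrite big1.
have z0 x' y' : piercings x' x' y' B = false by apply: piercings0 => t; apply: pierced_xxz.
have z1 x' y' : piercings x' y' y' B = false by apply: piercings0 => t; apply: pierced_xyy.
have z2 x' y' : piercings x' y' x' B = false by apply: piercings0 => t; apply: pierced_xyx.
have [eyz|yz] := eqVneq y z; first by rewrite -eyz z0 z1 /= addbb.
have [ezw|zw] := eqVneq z w; first by rewrite -ezw !z1 addbb.
move: xN; rewrite !inE !negb_or => /and3P[xy xz xw].
have [eyw|yw] := eqVneq y w.
  rewrite -eyw z1 z2 addbF (piercings_swap gL) ?addbb //=; last 2 first.
  - by rewrite /= !inE negb_or xy xz (eq_sym z) yz.
  - by move=> u; rewrite !inE => /or3P[]/eqP->; apply: dis; rewrite !inE eqxx ?orbT.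
  by move=> u; rewrite !inE => /or4P[/eqP->|/eqP->|/eqP->|uB];
    apply: sub; rewrite !inE ?eqxx ?uB ?orbT.
have notB u v : u \in [:: x; y; z; w] -> v \in ends B -> u != v.
  by move=> /dis uB vB; apply: contra uB => /eqP->.
suff: piercings y z w B (+) piercings x z w B (+) piercings x y w B (+) piercings x y z B =
    \xor_(t <- B) (inside x y z w t.1 (+) inside x y z w t.2).
  rewrite cB; do 4![case: (piercings _ _ _ _)] => //.
rewrite /piercings -!big_split /= !big_seq; apply: eq_bigr => t tB.
have [<-|neq] := eqVneq t.1 t.2; first by rewrite !pierced_point /= addbb.
have [t1 t2] := (ends1 tB, ends2 tB).
apply/pierced_tetra/(generic_generic6 gL).
  by move=> u; rewrite !inE => /or4P[/eqP->|/eqP->|/eqP->|/or3P[]/eqP->];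
    apply: sub; rewrite !inE ?eqxx ?t1 ?t2 ?orbT.
have xN v : v \in ends B -> x != v by apply: notB; rewrite !inE eqxx.
have yN v : v \in ends B -> y != v by apply: notB; rewrite !inE eqxx orbT.
have zN v : v \in ends B -> z != v by apply: notB; rewrite !inE eqxx !orbT.
have wN v : v \in ends B -> w != v by apply: notB; rewrite !inE eqxx !orbT.
by rewrite /= !inE !negb_or xy xz xw yz yw zw neq ?xN ?yN ?zN ?wN.
Qed.

Definition placed L e A B := [/\ generic L,
  {subset e :: ends A ++ ends B <= L}, e \notin ends A, e \notin ends B &
  {in ends A, forall u, u \notin ends B}].

Lemma placedC L e A B : placed L e A B -> placed L e B A.
Proof.
case=> gL sub eA eB dis; split=> //.
  by move=> u uin; apply: sub; move: uin; rewrite !inE !mem_cat => /or3P[] ->; rewrite ?orbT.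
by move=> u uB; apply/negP => /dis; rewrite uB.
Qed.

(** The cones from e and e' over the edge a a' and the triangles e e' a and
    e e' a' bound a tetrahedron; the triangles cancel in the sum over A. *)
Lemma crossing_apex L e e' A B : placed L e A B -> placed L e' A B ->
  e != e' -> closed_chain A -> closed_chain B -> crossing e A B = crossing e' A B.
Proof.
case=> gL sub eA eB dis [_ sub' eA' eB' _] ee' cA cB.
have : crossing e A B (+) crossing e' A B =
    \xor_(s <- A) (piercings e e' s.1 B (+) piercings e e' s.2 B).
  rewrite -big_split !big_seq; apply: eq_bigr => s sA /=.
  have [s1 s2] := (ends1 sA, ends2 sA).
  rewrite (@piercings_tetra L e e' s.1 s.2) //; first by do 3![case: (piercings _ _ _ _)].
  - move=> u; rewrite !inE => /or4P[/eqP->|/eqP->|/eqP->|/orP[/eqP->|uB]].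
    + by apply: sub; rewrite inE eqxx.
    + by apply: sub'; rewrite inE eqxx.
    + by apply: sub; rewrite inE mem_cat s1 orbT.
    + by apply: sub; rewrite inE mem_cat s2 orbT.
    + by apply: sub; rewrite inE mem_cat uB !orbT.
  - rewrite !inE !negb_or ee' /=.
    by apply/andP; split; apply: contra eA => /eqP->.
  - by move=> u; rewrite !inE => /or4P[]/eqP-> //; apply: dis.
by rewrite (cA (fun u => piercings e e' u B)); case: crossing; case: crossing.
Qed.

(** The triangles e a a' and e' b b' pierce each other evenly.  In the sum
    over all edges a a' of A and b b' of B the edges at e' cancel because B is
    closed, and the edges at e because A is. *)
Lemma crossing_cross L e e' A B : placed L e A B -> placed L e' A B ->
  e != e' -> closed_chain A -> closed_chain B -> crossing e A B = crossing e' B A.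
Proof.
case=> gL sub eA eB dis [_ sub' eA' eB' _] ee' cA cB.
pose F s t := pierced e s.1 s.2 e' t.1 (+) pierced e s.1 s.2 e' t.2.
pose G t s := pierced e' t.1 t.2 e s.1 (+) pierced e' t.1 t.2 e s.2.
have F0 : \xor_(s <- A) \xor_(t <- B) F s t = false.
  by rewrite big1 // => s _; apply: (cB (fun u => pierced e s.1 s.2 e' u)).
have G0 : \xor_(s <- A) \xor_(t <- B) G t s = false.
  by rewrite exchange_big big1 // => t _; apply: (cA (fun u => pierced e' t.1 t.2 e u)).
suff: crossing e A B (+) \xor_(s <- A) \xor_(t <- B) F s t =
      crossing e' B A (+) \xor_(s <- A) \xor_(t <- B) G t s.
  by rewrite F0 G0 !addbF.
rewrite /crossing /piercings.
rewrite [X in _ = X (+) _]exchange_big -!big_split big_seq [RHS]big_seq; apply: eq_bigr => s sA.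
rewrite -!big_split big_seq [RHS]big_seq; apply: eq_bigr => t tB /=.
have [[s1 s2] [t1 t2]] := (ends1 sA, ends2 sA, (ends1 tB, ends2 tB)).
rewrite /F /G.
have [<-|ns] := eqVneq s.1 s.2.
  by rewrite !pierced_xyy pierced_point /= addbb.
have [<-|nt] := eqVneq t.1 t.2.
  by rewrite !pierced_xyy pierced_point /= addbb.
suff g6 : generic6 e s.1 s.2 e' t.1 t.2.
  by have := pierced_triangles g6; do 6![case: (pierced _ _ _ _ _)].
  apply: (generic_generic6 gL).
    move=> u; rewrite !inE => /or4P[/eqP->|/eqP->|/eqP->|/or3P[]/eqP->].
    + by apply: sub; rewrite inE eqxx.
    + by apply: sub; rewrite inE mem_cat s1 orbT.
    + by apply: sub; rewrite inE mem_cat s2 orbT.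
    + by apply: sub'; rewrite inE eqxx.
    + by apply: sub; rewrite inE mem_cat t1 !orbT.
    + by apply: sub; rewrite inE mem_cat t2 !orbT.
  have ne u v (X : seq point) : u \notin X -> v \in X -> u != v.
    by move=> uX vX; apply: contra uX => /eqP->.
  have se' v : v \in ends A -> v != e' by move=> vA; rewrite eq_sym (ne _ _ _ eA').
  have st v v' : v \in ends A -> v' \in ends B -> v != v'.
    by move=> /dis vB; apply: ne.
  by rewrite /= !inE !negb_or ee' ns nt (ne _ _ _ eA s1) (ne _ _ _ eA s2)
    (ne _ _ _ eB t1) (ne _ _ _ eB t2) (ne _ _ _ eB' t1) (ne _ _ _ eB' t2)
    !se' ?st.
Qed.

Lemma crossingC L e e' A B : placed L e A B -> placed L e' A B ->
  e != e' -> closed_chain A -> closed_chain B -> crossing e A B = crossing e B A.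
Proof.
move=> p p' ee' cA cB; rewrite (crossing_cross p p') //.
by apply: (crossing_apex (placedC p') (placedC p)); rewrite // eq_sym.
Qed.

Definition push (g : point -> point) A := [seq (g s.1, g s.2) | s <- A].

Lemma push_closed g A : closed_chain A -> closed_chain (push g A).
Proof. by move=> cA phi; rewrite big_map (cA (phi \o g)). Qed.

(** The quadrilateral swept out by an edge from its g-image to its k-image
    is filled by two triangles that B pierces evenly; their cones from e are
    tetrahedra, and the faces over the paths of the vertices cancel in the
    sum over the closed chain A. *)
Lemma crossing_homotopy L e g k A B : generic L -> closed_chain A -> closed_chain B ->
  placed L e (push g A) B -> placed L e (push k A) B ->
  {in A, forall s, piercings (g s.1) (g s.2) (k s.2) B = false} ->
  {in A, forall s, piercings (g s.1) (k s.1) (k s.2) B = false} ->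
  crossing e (push g A) B = crossing e (push k A) B.
Proof.
move=> gL cA cB [_ subg eA eB disg] [_ subk ekA _ disk] f1 f2.
rewrite /crossing !big_map.
have : \xor_(s <- A) piercings e (g s.1) (g s.2) B (+) \xor_(s <- A) piercings e (k s.1) (k s.2) B =
    \xor_(s <- A) (piercings e (g s.1) (k s.1) B (+) piercings e (g s.2) (k s.2) B).
  rewrite -big_split !big_seq; apply: eq_bigr => s sA /=.
  have sg : (g s.1, g s.2) \in push g A by apply/mapP; exists s.
  have sk : (k s.1, k s.2) \in push k A by apply/mapP; exists s.
  have mem u : u \in ends (push g A) \/ u \in ends (push k A) ->
      u \in ends (push g A) ++ ends (push k A).
    by case=> h; rewrite mem_cat h ?orbT.
  have g1 := mem _ (or_introl (ends1 sg)); have g2 := mem _ (or_introl (ends2 sg)).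
  have k1 := mem _ (or_intror (ends1 sk)); have k2 := mem _ (or_intror (ends2 sk)).
  rewrite /= in g1 g2 k1 k2.
  have ne u (X : seq point) : e \notin X -> u \in X -> e != u.
    by move=> eX uX; apply: contra eX => /eqP->.
  have tet x y z : x \in ends (push g A) ++ ends (push k A) ->
      y \in ends (push g A) ++ ends (push k A) ->
      z \in ends (push g A) ++ ends (push k A) ->
      piercings x y z B = piercings e x y B (+) piercings e x z B (+) piercings e y z B.
    have ok u : u \in ends (push g A) ++ ends (push k A) ->
       [/\ u \in L, u != e & u \notin ends B].
      rewrite mem_cat => /orP[] uX; split.
      + by apply: subg; rewrite inE mem_cat uX orbT.
      + by rewrite eq_sym (ne _ _ eA).
      + exact: disg.
      + by apply: subk; rewrite inE mem_cat uX orbT.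
      + by rewrite eq_sym (ne _ _ ekA).
      + exact: disk.
    move=> /ok[xL xe xB] /ok[yL ye yB] /ok[zL ze zB].
    apply: (piercings_tetra gL) => //.
    + move=> u; rewrite !inE => /or4P[/eqP->|/eqP->|/eqP->|/orP[/eqP->|uB]] //;
      by apply: subg; rewrite inE ?eqxx // mem_cat uB !orbT.
    + by rewrite !inE !negb_or ![e == _]eq_sym xe ye ze.
    + by move=> u; rewrite !inE => /or4P[]/eqP->.
  have := f1 s sA; have := f2 s sA.
  rewrite (tet _ _ _ g1 k1 k2) (tet _ _ _ g1 g2 k2).
  have quad (u v w x y : bool) : u (+) v (+) w = false ->
    x (+) v (+) y = false -> x (+) w = u (+) y by move: u v w x y; do 5!case.
  exact: quad.
have := cA (fun u => piercings e (g u) (k u) B) => /= ->.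
by move: (\xor_(s <- A) _) (\xor_(s <- A) _); do 2!case.
Qed.
End Chains.

(** * Pairs of disjoint edges of the complete bipartite graph on 3 + 3 vertices *)

Local Notation "\xor_ ( i | P ) F" := (\big[addb/false]_(i | P%B) F%B)
  (at level 41, F at level 41, i at level 50).
Local Notation "\xor_ i F" := (\big[addb/false]_i F%B)
  (at level 41, F at level 41, i at level 0).

Definition disjoint_edges_sum (X : 'I_3 -> 'I_3 -> 'I_3 -> 'I_3 -> bool) :=
  \xor_a \xor_(i | i != a) \xor_b \xor_(j | j != b) X a b i j.

Lemma xor3 (P F : 'I_3 -> bool) : \xor_(i | P i) F i =
  P ord0 && F ord0 (+) P (lift ord0 ord0) && F (lift ord0 ord0) (+)
  P (lift ord0 (lift ord0 ord0)) && F (lift ord0 (lift ord0 ord0)).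
Proof.
by rewrite big_mkcond !big_ord_recl big_ord0 /= addbF addbA; do 3![case: (P _)].
Qed.

Lemma disjoint_edges_sumD X Y :
  disjoint_edges_sum (fun a b i j => X a b i j (+) Y a b i j) =
  disjoint_edges_sum X (+) disjoint_edges_sum Y.
Proof.
rewrite /disjoint_edges_sum; do 4![rewrite -?big_split; apply: eq_bigr => ? _].
by [].
Qed.

Lemma eq_disjoint_edges_sum X Y :
  (forall a b i j, i != a -> j != b -> X a b i j = Y a b i j) ->
  disjoint_edges_sum X = disjoint_edges_sum Y.
Proof. by move=> XY; do 4!apply: eq_bigr => ? ?; apply: XY. Qed.

(** There are two indices other than a.  This is where the number 3 enters:
    a term that does not depend on one of the four indices of a pair of
    disjoint edges cancels in the sum over all pairs. *)
Lemma xor_other (c : bool) (a : 'I_3) : \xor_(i | i != a) c = false.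
Proof. by rewrite big_const cardC1 card_ord /= addbF addbb. Qed.

Lemma sum_indep_j Y : disjoint_edges_sum (fun a b i _ => Y a b i) = false.
Proof. by rewrite /disjoint_edges_sum; do 3![rewrite big1 // => ? _]; apply: xor_other. Qed.

Lemma sum_swapB X : disjoint_edges_sum X = disjoint_edges_sum (fun a b i j => X a j i b).
Proof.
do 2!apply: eq_bigr => ? _; rewrite (exchange_big_dep predT) //=.
by apply: eq_bigr => b _; apply: eq_bigl => j; rewrite eq_sym.
Qed.

Lemma sum_swapA X : disjoint_edges_sum X = disjoint_edges_sum (fun a b i j => X i b a j).
Proof.
rewrite /disjoint_edges_sum (exchange_big_dep predT) //=.
by apply: eq_bigr => b _; apply: eq_bigl => j; rewrite eq_sym.
Qed.

Lemma sum_indep_b Y : disjoint_edges_sum (fun a _ i j => Y a i j) = false.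
Proof. by rewrite sum_swapB; apply: (sum_indep_j (fun a j i => Y a i j)). Qed.

Lemma sum_indep_i Y : disjoint_edges_sum (fun a b _ j => Y a b j) = false.
Proof.
rewrite /disjoint_edges_sum big1 // => a _; apply: xor_other.
Qed.

Lemma sum_indep_a Y : disjoint_edges_sum (fun _ b i j => Y b i j) = false.
Proof. by rewrite sum_swapA; apply: (sum_indep_i (fun i b j => Y b i j)). Qed.

Lemma sum_swap X : disjoint_edges_sum X = disjoint_edges_sum (fun a b i j => X i j a b).
Proof. by rewrite sum_swapA sum_swapB. Qed.

(** Each unordered pair of disjoint edges is counted twice. *)
Lemma sum_symmetric X : (forall a b i j, i != a -> j != b -> X a b i j = X i j a b) ->
  disjoint_edges_sum X = false.
Proof.
move=> symX; pose S a i := \xor_b \xor_(j | j != b) X a b i j.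
have symS a i : i != a -> S a i = S i a.
  move=> ia; rewrite /S (exchange_big_dep predT) //=.
  apply: eq_bigr => b _; rewrite [RHS](eq_bigl (fun j => b != j)); last first.
    by move=> j; rewrite eq_sym.
  by apply: eq_bigr => j jb; apply: symX.
pose i0 : 'I_3 := ord0; pose i1 : 'I_3 := lift ord0 ord0.
pose i2 : 'I_3 := lift ord0 (lift ord0 ord0).
move: symS; rewrite -[LHS]/(\xor_a \xor_(i | i != a) S a i); move: S => S symS.
rewrite !xor3 /= (symS i0 i1) // (symS i0 i2) // (symS i1 i2) //.
by move: (S _ _) (S _ _) (S _ _); do 3!case.
Qed.

Section Crossings. Variable R : realFieldType.
Local Notation point := 'rV[R]_3.
Implicit Types (x y z w : point) (L : seq point) (A B : seq (point * point)).

Lemma crossing_catl e A A' B :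
  crossing e (A ++ A') B = crossing e A B (+) crossing e A' B.
Proof. by rewrite /crossing big_cat. Qed.

Lemma crossing_catr e A B B' :
  crossing e A (B ++ B') = crossing e A B (+) crossing e A B'.
Proof. by rewrite /crossing -big_split /=; apply: eq_bigr => s _; rewrite /piercings big_cat. Qed.

Lemma crossing_nill e B : crossing e [::] B = false.
Proof. by rewrite /crossing big_nil. Qed.

Lemma crossing_nilr e A : crossing e A [::] = false.
Proof. by rewrite /crossing big1 // => s _; rewrite /piercings big_nil. Qed.

Definition avoiding (E : 'I_3 -> 'I_3 -> seq (point * point)) a b :=
  \big[cat/[::]]_(i | i != a) \big[cat/[::]]_(j | j != b) E i j.

Lemma crossing_avoidingr e A E a b : crossing e A (avoiding E a b) =
  \xor_(i | i != a) \xor_(j | j != b) crossing e A (E i j).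
Proof.
rewrite /avoiding (big_morph _ (crossing_catr e A) (crossing_nilr e A)).
by apply: eq_bigr => i _; rewrite (big_morph _ (crossing_catr e A) (crossing_nilr e A)).
Qed.

Lemma crossing_avoidingl e B E a b : crossing e (avoiding E a b) B =
  \xor_(i | i != a) \xor_(j | j != b) crossing e (E i j) B.
Proof.
pose cl A A' := crossing_catl e A A' B.
rewrite /avoiding (big_morph _ cl (crossing_nill e B)).
by apply: eq_bigr => i _; rewrite (big_morph _ cl (crossing_nill e B)).
Qed.

(** The two ends of a chain, in the dual form used for closed chains. *)
Definition bounds A x y := forall phi : point -> bool,
  \xor_(s <- A) (phi s.1 (+) phi s.2) = phi x (+) phi y.

(** With three vertices in each part every vertex other than the ends of the
    edge a b lies on two of the edges that avoid a and b. *)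
Lemma avoiding_closed E p p' a b :
  (forall i j, bounds (E i j) (p i) (p' j)) -> closed_chain (avoiding E a b).
Proof.
move=> bE phi; rewrite /avoiding.
have cat0 A A' : \xor_(s <- A ++ A') (phi s.1 (+) phi s.2) =
  (\xor_(s <- A) (phi s.1 (+) phi s.2)) (+) \xor_(s <- A') (phi s.1 (+) phi s.2).
  by rewrite big_cat.
have nil0 : \xor_(s <- [::]) (phi s.1 (+) phi s.2) = false by rewrite big_nil.
rewrite (big_morph _ cat0 nil0).
under eq_bigr => i _.
  rewrite (big_morph _ cat0 nil0); under eq_bigr do rewrite bE.
  rewrite big_split xor_other /=; over.
by rewrite xor_other.
Qed.

(** The moment curve, on which all volumes are Vandermonde determinants. *)
Definition curve (n : nat) : point := \row_i n%:R ^+ i.+1.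

Lemma vol_curve i j k l : vol (curve i) (curve j) (curve k) (curve l) =
  (j%:R - i%:R) * (k%:R - i%:R) * (l%:R - i%:R) *
  (k%:R - j%:R) * (l%:R - j%:R) * (l%:R - k%:R).
Proof. by rewrite /vol /det3 /curve !mxE /=; ring. Qed.

Definition inversions (i j k l : nat) : bool :=
  ((i < j) (+) (i < k) (+) (i < l) (+) (j < k) (+) (j < l) (+) (k < l))%N.

Lemma pos_curve i j k l : uniq [:: i; j; k; l] ->
  pos (curve i) (curve j) (curve k) (curve l) = ~~ inversions i j k l.
Proof.
have mul_pos (u v : R) : u != 0 -> v != 0 -> (0 < u * v) = ~~ ((0 < u) (+) (0 < v)).
  move=> u0 v0; case: (ltgtP 0 u) u0 => // hu _.
    by rewrite pmulr_rgt0 //; case: ltgtP.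
  by rewrite nmulr_rgt0 //; case: ltgtP v0.
have sub0 m n : m != n -> (n%:R - m%:R : R) != 0.
  by move=> mn; rewrite subr_eq0 eqr_nat eq_sym.
rewrite /= !inE !negb_or !andbT => /and3P[/and3P[ij ik il] /andP[jk jl] kl].
rewrite /pos vol_curve !mul_pos ?mulf_neq0 ?sub0 // !subr_gt0 !ltr_nat /inversions.
by do 6![case: (_ < _)%N].
Qed.

(** Seen from the point of parameter 0, the points of parameters 1 to 6 of the
    moment curve are the corners of a convex hexagon in their cyclic order,
    with the two parts alternating.  Of its sides and long diagonals, which
    form K_{3,3}, only the three long diagonals cross. *)
Lemma hexagon_crossings : disjoint_edges_sum (fun a b i j =>
  pierced (curve 0) (curve a.*2.+1) (curve b.*2.+2) (curve i.*2.+1) (curve j.*2.+2)).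
Proof.
pose inv (i j k l : nat) := ~~ inversions i j k l.
rewrite (@eq_disjoint_edges_sum _ (fun a b i j => let: (x, y, z, w) :=
   (a.*2.+1, b.*2.+2, i.*2.+1, j.*2.+2) in
   alike (inv x y z w) (~~ inv 0 y z w) (inv 0 x z w) (inv 0 x y w)
     (~~ inv 0 x y z))); last first.
  move=> a b i j ia jb; rewrite /pierced.
  have oe (k l : nat) : (k.*2 == l.*2.+1) = false.
    by apply/eqP => /(congr1 odd); rewrite /= !odd_double.
  have ia2 : (a.*2 == i.*2) = false by rewrite -!muln2 eqn_pmul2r // eq_sym; apply: negbTE.
  have jb2 : (b.*2 == j.*2) = false by rewrite -!muln2 eqn_pmul2r // eq_sym; apply: negbTE.
  by rewrite !pos_curve //= !inE !eqSS ?oe ?ia2 ?jb2 // ?(eq_sym _.+1) ?oe.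
rewrite /disjoint_edges_sum.
by rewrite !xor3; vm_compute.
Qed.
End Crossings.

(** * The total linking number is odd *)

Section Parity. Variable R : realFieldType.
Local Notation point := 'rV[R]_3.
Implicit Types (x y z w : point) (L : seq point) (A B : seq (point * point)).
Implicit Types (E : 'I_3 -> 'I_3 -> seq (point * point)).

Lemma ends_cat A B : ends (A ++ B) =i ends A ++ ends B.
Proof. by move=> x; rewrite !mem_cat /unzip1 /unzip2 !map_cat !mem_cat orbACA. Qed.

Lemma mem_ends_cat x A B :
  (x \in ends (A ++ B)) = (x \in ends A) || (x \in ends B).
Proof. by rewrite ends_cat mem_cat. Qed.

Lemma ends_avoiding E a b x :
  (x \in ends (avoiding E a b)) =
  [exists i, exists j, [&& i != a, j != b & x \in ends (E i j)]].
Proof.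
have e_cat (A B : seq (point * point)) :
  (x \in ends (A ++ B)) = (x \in ends A) || (x \in ends B).
  exact: mem_ends_cat.
have e0 : (x \in ends [::]) = false by [].
rewrite /avoiding (big_morph _ e_cat e0).
under eq_bigr do rewrite (big_morph _ e_cat e0).
rewrite big_orE; apply: eq_existsb => i; rewrite big_orE.
apply/andP/existsP => [[ia /existsP[j /andP[jb xE]]]|[j /and3P[ia jb xE]]].
  by exists j; apply/and3P.
by split=> //; apply/existsP; exists j; rewrite jb.
Qed.

Lemma bounds_closed A B x y : bounds A x y -> bounds B x y -> closed_chain (A ++ B).
Proof. by move=> bA bB phi; rewrite big_cat bA bB /= addbb. Qed.

Lemma bounds_cat A B x y z : bounds A x y -> bounds B y z -> bounds (A ++ B) x z.
Proof. by move=> bA bB phi; rewrite big_cat bA bB /=; case: (phi x) (phi y) (phi z) => [] [] []. Qed.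

(** The path F a belongs to the triangles of a and of both choices for the
    other index, so each edge that avoids a is counted twice against it; the
    same holds for F' b. *)
Lemma cone_edges_cancel e (F F' : 'I_3 -> seq (point * point)) E :
  \xor_a \xor_b crossing e (F a ++ E a b ++ F' b) (avoiding E a b) =
  disjoint_edges_sum (fun a b i j => crossing e (E a b) (E i j)).
Proof.
transitivity (disjoint_edges_sum (fun a b i j => crossing e (F a) (E i j) (+)
   (crossing e (E a b) (E i j) (+) crossing e (F' b) (E i j)))).
  apply: eq_bigr => a _; rewrite [RHS]exchange_big; apply: eq_bigr => b _.
  rewrite !crossing_catl !crossing_avoidingr -!big_split /=; apply: eq_bigr => i _.
  by rewrite -!big_split.
rewrite !disjoint_edges_sumD (sum_indep_b (fun a i j => crossing e (F a) (E i j))).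
by rewrite (sum_indep_a (fun b i j => crossing e (F' b) (E i j))) addbF.
Qed.

Section Sum.
Variables (L : seq point) (p p' : 'I_3 -> point) (E : 'I_3 -> 'I_3 -> seq (point * point)).
Hypothesis gL : generic L.
Hypothesis curveL : forall n, (n < 8)%N -> curve R n \in L.
Hypothesis E_L : forall a b, {subset ends (E a b) <= L}.
Hypothesis E_curve : forall a b n, (n < 8)%N -> curve R n \notin ends (E a b).
Hypothesis E_bounds : forall a b, bounds (E a b) (p a) (p' b).
Hypothesis pE : forall a b, p a \in ends (E a b).
Hypothesis p'E : forall a b, p' b \in ends (E a b).
Hypothesis E_disjoint : forall a b i j, i != a -> j != b ->
  {in ends (E a b), forall x, x \notin ends (E i j)}.

Let q (a : nat) := curve R a.*2.+1.
Let q' (b : nat) := curve R b.*2.+2.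
Let M (a b : 'I_3) := [:: (p a, q a); (q a, q' b); (q' b, p' b)].
Let Z a b := E a b ++ M a b.

Let M_bounds a b : bounds (M a b) (p a) (p' b).
Proof.
move=> phi; rewrite !big_cons big_nil /=.
by case: (phi (p a)) (phi (q a)) (phi (q' b)) (phi (p' b)) => [] [] [] [].
Qed.

Let Z_closed a b : closed_chain (Z a b).
Proof. exact: bounds_closed (E_bounds a b) (M_bounds a b). Qed.

Lemma curve_inj : injective (curve R).
Proof.
move=> m n /rowP/(_ 0); rewrite !mxE !expr1 => /eqP.
by rewrite eqr_nat => /eqP.
Qed.

Let endsM a b x : x \in ends (M a b) ->
  x \in ends (E a b) \/ (exists2 n, (0 < n < 7)%N & x = curve R n).
Proof.
have small (k : 'I_3) : (0 < k.*2.+1 < 7)%N && (0 < k.*2.+2 < 7)%N.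
  by case: k => -[|[|[]]].
rewrite !inE => /or4P[/eqP->|/eqP->|/eqP->|/or3P[]/eqP->]; rewrite ?pE ?p'E; first [by left|right].
- by exists a.*2.+1 => //; case/andP: (small a).
- by exists b.*2.+2 => //; case/andP: (small b).
- by exists a.*2.+1 => //; case/andP: (small a).
- by exists b.*2.+2 => //; case/andP: (small b).
Qed.

Let endsZ a b x : x \in ends (Z a b) ->
  [/\ x \in L, x != curve R 0 & x != curve R 7].
Proof.
rewrite mem_ends_cat => H.
have {H}: x \in ends (E a b) \/ (exists2 n, (0 < n < 7)%N & x = curve R n).
  by case/orP: H => [xE|]; [left|exact: endsM].
case=> [xE|[n /andP[n0 n7] ->]].
  by split; [exact: E_L xE| |]; apply: contraTneq xE => ->; apply: E_curve.
split; first by apply/curveL/(ltn_trans n7).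
  by apply: contraTneq n0 => /curve_inj ->.
by apply: contraTneq n7 => /curve_inj ->.
Qed.

Let Z_disjoint a b i j : i != a -> j != b ->
  {in ends (Z a b), forall x, x \notin ends (Z i j)}.
Proof.
move=> ia jb x; rewrite !mem_ends_cat.
have cE k l n : (0 < n < 7)%N -> curve R n \notin ends (E k l).
  by case/andP=> _ n7; apply/E_curve/(ltn_trans n7).
have xEM : x \in ends (E a b) -> x \notin ends (E i j) /\ x \notin ends (M i j).
  move=> xE; have nE := E_disjoint ia jb xE; split=> //.
  apply/negP => /endsM[xE'|[n n7 en]]; first by rewrite xE' in nE.
  by move: (cE a b n n7); rewrite -en xE.
case/orP=> [/xEM[/negbTE-> /negbTE->]|xM] //.
case: (endsM xM) => [/xEM[/negbTE-> /negbTE->]|[n n7 en]] //.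
rewrite negb_or {1}en cE //=; apply/negP => xM'.
case: (endsM xM') => [xE'|_]; first by move: (cE i j n n7); rewrite -en xE'.
have cM k l : x \in ends (M k l) -> x = q k \/ x = q' l.
  have pc y k' l' : y \in ends (E k' l') -> x <> y.
    by move=> yE xy; move: (cE k' l' n n7); rewrite -en xy yE.
  rewrite !inE => /or4P[/eqP/(pc _ _ _ (pE k l))|/eqP|/eqP|/or3P[]/eqP] //;
    by [left|right|move/(pc _ _ _ (p'E k l))].
move: ia jb; case: (cM _ _ xM) (cM _ _ xM') => -> [] /curve_inj /eqP;
  rewrite !eqSS.
- by rewrite -!muln2 eqn_pmul2r // => /eqP/val_inj ->; rewrite eqxx.
- by move=> /eqP /(congr1 odd); rewrite /= !odd_double.
- by move=> /eqP /(congr1 odd); rewrite /= !odd_double.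
- by rewrite -!muln2 eqn_pmul2r // => /eqP/val_inj ->; rewrite eqxx.
Qed.

Let sub_placed n A B : n \in [:: 0; 7]%N ->
  (forall x, x \in ends A -> exists a b, x \in ends (Z a b)) ->
  (forall x, x \in ends B -> exists a b, x \in ends (Z a b)) ->
  {in ends A, forall x, x \notin ends B} -> placed L (curve R n) A B.
Proof.
move=> nin hA hB dis.
have ok x : (exists a b, x \in ends (Z a b)) -> x \in L /\ x != curve R n.
  move=> [a [b /endsZ[xL x0 x7]]]; split=> //.
  by move: nin; rewrite !inE => /orP[]/eqP->.
split=> //.
- move=> x; rewrite inE mem_cat => /or3P[/eqP->|/hA/ok[]//|/hB/ok[]//].
  by apply: curveL; move: nin; rewrite !inE => /orP[]/eqP->.
- by apply/negP => /hA/ok[_]; rewrite eqxx.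
- by apply/negP => /hB/ok[_]; rewrite eqxx.
Qed.

Let crossZ A B :
  (forall x, x \in ends A -> exists a b, x \in ends (Z a b)) ->
  (forall x, x \in ends B -> exists a b, x \in ends (Z a b)) ->
  {in ends A, forall x, x \notin ends B} -> closed_chain A -> closed_chain B ->
  crossing (curve R 0) A B = crossing (curve R 0) B A.
Proof.
move=> hA hB dis cA cB; apply: (@crossingC _ L _ (curve R 7)) => //.
- exact: sub_placed.
- exact: sub_placed.
- by apply/eqP => /curve_inj.
Qed.

Let e := curve R 0.
Let X (U V : 'I_3 -> 'I_3 -> seq (point * point)) a b i j :=
  crossing e (U a b) (V i j).

(** The chains E a b and M a b have the same ends, so they differ by a cycle
    Z a b.  Against a fixed edge, Z a b and the quadrilateral of the disjoint
    edges cross over each other equally often, and the terms in which a cycle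
    meets a cycle cancel by symmetry. *)
Let sum_EE_MM : disjoint_edges_sum (X E E) = disjoint_edges_sum (X M M).
Proof.
suff: disjoint_edges_sum (fun a b i j => X Z Z a b i j (+)
       (X Z M a b i j (+) X M Z a b i j)) = false.
  move=> s0; apply: addbI (disjoint_edges_sum (X M M)) _ _ _.
  rewrite addbb -disjoint_edges_sumD -[RHS]s0.
  apply: eq_disjoint_edges_sum => a b i j _ _.
  rewrite /X /Z !crossing_catl !crossing_catr.
  by move: (crossing _ _ _) (crossing _ _ _) (crossing _ _ _) (crossing _ _ _); do 4!case.
have ZM : disjoint_edges_sum (X Z M) = disjoint_edges_sum (X M Z).
  rewrite [RHS]sum_swap /disjoint_edges_sum.
  apply: eq_bigr => a _; rewrite exchange_big [RHS]exchange_big.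
  apply: eq_bigr => b _; rewrite -crossing_avoidingr -crossing_avoidingl.
  apply: crossZ => //.
  - by move=> x xZ; exists a, b.
  - move=> x; rewrite ends_avoiding => /existsP[i /existsP[j /and3P[_ _ xM]]].
    by exists i, j; rewrite mem_ends_cat xM orbT.
  - move=> x xZ; rewrite ends_avoiding; apply/negP.
    case/existsP=> i /existsP[j /and3P[ia jb xM]].
    by move: (Z_disjoint ia jb xZ); rewrite mem_ends_cat xM orbT.
  - exact: avoiding_closed M_bounds.
rewrite !disjoint_edges_sumD ZM addbb addbF.
apply: sum_symmetric => a b i j ia jb; apply: crossZ => //.
- by move=> x xZ; exists a, b.
- by move=> x xZ; exists i, j.
- exact: Z_disjoint.
Qed.

Let m a b i j := pierced e (q a) (q' b) (q i) (q' j).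

(** A spoke p a -- q a does not depend on b, so all its crossings cancel, and
    only the crossings of the edges of the hexagon remain. *)
Let sum_MM : disjoint_edges_sum (X M M).
Proof.
pose Q (k l : 'I_3) := [:: (q k, q' l)]; pose P (k : 'I_3) := [:: (p k, q k)].
pose P' (l : 'I_3) := [:: (q' l, p' l)].
have -> : disjoint_edges_sum (X M M) = disjoint_edges_sum (fun a b i j =>
   (crossing e (P a) (P i) (+) crossing e (P a) (Q i j)) (+) crossing e (P a) (P' j) (+)
   (crossing e (Q a b) (P i) (+) m a b i j (+) crossing e (Q a b) (P' j)) (+)
   (crossing e (P' b) (P i) (+) crossing e (P' b) (Q i j) (+) crossing e (P' b) (P' j))).
  apply: eq_disjoint_edges_sum => a b i j _ _.
  have ME k l : M k l = P k ++ Q k l ++ P' l by [].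
  have mE : m a b i j = crossing e (Q a b) (Q i j).
    by rewrite /crossing /piercings !big_seq1.
  by rewrite /X mE !ME !crossing_catl !crossing_catr !addbA.
rewrite !disjoint_edges_sumD.
rewrite (sum_indep_b (fun a i j => crossing e (P a) (P i))).
rewrite (sum_indep_b (fun a i j => crossing e (P a) (Q i j))).
rewrite (sum_indep_b (fun a i j => crossing e (P a) (P' j))).
rewrite (sum_indep_j (fun a b i => crossing e (Q a b) (P i))).
rewrite (sum_indep_i (fun a b j => crossing e (Q a b) (P' j))).
rewrite (sum_indep_a (fun b i j => crossing e (P' b) (P i))).
rewrite (sum_indep_a (fun b i j => crossing e (P' b) (Q i j))).
rewrite (sum_indep_a (fun b i j => crossing e (P' b) (P' j))).
by rewrite /= !addbF; apply: (hexagon_crossings R).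
Qed.

(** The nine linking numbers of the triangles with their disjoint
    quadrilaterals add up to 1; the apex C enters only through the paths F
    and F' that lead to it. *)
Lemma odd_total_crossing (F F' : 'I_3 -> seq (point * point)) :
  \xor_a \xor_b crossing (curve R 0) (F a ++ E a b ++ F' b) (avoiding E a b).
Proof. by rewrite cone_edges_cancel; move: sum_MM; rewrite -sum_EE_MM. Qed.

End Sum.
End Parity.

(** * Moving points into general position *)

Section Perturbation. Variable R : realType.
Local Notation point := 'rV[R]_3.
Implicit Types (x y z w : point) (L X : seq point).

Lemma row_norm_lt n (v : 'rV[R]_n) e : 0 < e -> (forall i, `|v 0 i| < e) -> `|v| < e.
Proof.
move=> e0 lt; rewrite -[`|v|]/(mx_norm v) mx_normrE; apply: bigmax_lt => // -[i j] _ /=.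
by rewrite (ord1 i).
Qed.

Lemma small_nonroot (p : {poly R}) e : p != 0 -> 0 < e ->
  exists2 t, 0 < t < e & ~~ root p t.
Proof.
move=> p0 e0; pose s := [seq e / k.+2%:R | k <- iota 0 (size p)].
have us : uniq s.
  rewrite map_inj_uniq ?iota_uniq // => j k /(mulfI (lt0r_neq0 e0))/invr_inj/eqP.
  by rewrite eqr_nat => /eqP[].
have /allPn[t ts rt] : ~~ all (root p) s.
  apply/negP => /(max_poly_roots p0)/(_ us).
  by rewrite size_map size_iota ltnn.
exists t => //; case/mapP: ts => k _ ->.
by rewrite divr_gt0 //= gtr_pMr // invf_lt1 // ltr1n.
Qed.

(** vol x y z along the moment curve translated to w.  Its coefficients other
    than the constant one are those of the linear form vol x y z, so it does
    not vanish when x, y, z are not collinear. *)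
Definition vol_poly x y z w : {poly R} :=
  let n := [:: vol x y z (x + delta_mx 0 0); vol x y z (x + delta_mx 0 1);
               vol x y z (x + delta_mx 0 2)] in
  (vol x y z w)%:P + n`_0 *: 'X + n`_1 *: 'X^2 + n`_2 *: 'X^3.

Lemma vol_polyE x y z w (t : R) :
  (vol_poly x y z w).[t] = vol x y z (w + \row_i t ^+ i.+1).
Proof.
rewrite /vol_poly !hornerE /= /vol /det3 !mxE /=.
ring.
Qed.

Lemma vol_poly_neq0 x y z w u : vol x y z u != 0 -> vol_poly x y z w != 0.
Proof.
apply: contra => /eqP/polyP coef0.
have := (coef0 1, coef0 2, coef0 3).
rewrite /vol_poly !coefE /= !mulr1 !mulr0 !addr0 !add0r => -[[h1 h2] h3].
apply/eqP.
have -> : vol x y z u = vol x y z (x + delta_mx 0 0) * (u - x) 0 0 +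
  vol x y z (x + delta_mx 0 1) * (u - x) 0 1 + vol x y z (x + delta_mx 0 2) * (u - x) 0 2.
  by rewrite /vol /det3 !mxE /=; ring.
by rewrite h1 h2 h3 !mul0r !addr0.
Qed.

Lemma generic_cons L u : generic L ->
  (forall x y z, {subset [:: x; y; z] <= L} -> uniq [:: x; y; z] -> vol x y z u != 0) ->
  generic (u :: L).
Proof.
move=> gL gu x y z w sub.
have tail a b c : u \notin [:: a; b; c] -> {subset [:: a; b; c] <= u :: L} ->
    {subset [:: a; b; c] <= L}.
  move=> ua s i ii; move: (s i ii); rewrite inE => /orP[/eqP iu|//].
  by rewrite -iu ii in ua.
rewrite /= !inE !negb_or -!andbA => /and5P[xy xz xw yz /and3P[yw zw _]].
have perm a b c d s : perm_eq [:: x; y; z; w] [:: a; b; c; d] -> u = d ->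
    vol x y z w = s * vol a b c u -> s != 0 -> vol x y z w != 0.
  move=> pm ud -> s0; have un : uniq [:: a; b; c; d].
    by rewrite -(perm_uniq pm) /= !inE !negb_or xy xz xw yz yw zw.
  have un' : uniq [:: d; a; b; c] by rewrite -(rot_uniq 1).
  rewrite mulf_neq0 // gu //; last by case/andP: un'.
  apply: tail; first by rewrite ud; case/andP: un'.
  by move=> i ii; apply: sub; rewrite (perm_mem pm) -(mem_rot 3) inE ii orbT.
have N1 : (-1 : R) != 0 by rewrite oppr_eq0 oner_eq0.
have [ex|xu] := eqVneq u x.
  apply: (perm y z w x (-1) _ ex _ N1); first by rewrite -(perm_rot 1).
  by rewrite ex /vol /det3 !mxE; ring.
have [ey|yu] := eqVneq u y.
  apply: (perm x z w y 1 _ ey _ (oner_neq0 _)).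
    by rewrite perm_cons -(perm_rot 1).
  by rewrite ey /vol /det3 !mxE; ring.
have [ez|zu] := eqVneq u z.
  apply: (perm x y w z (-1) _ ez _ N1).
    by rewrite !perm_cons -(perm_rot 1).
  by rewrite ez /vol /det3 !mxE; ring.
have [ew|wu] := eqVneq u w.
  by apply: (perm x y z w 1) => //; rewrite ?oner_eq0 // ew mul1r.
apply: gL; last by rewrite /= !inE !negb_or xy xz xw yz yw zw.
move=> i ii; move: (sub i ii); rewrite inE => /orP[/eqP iu|//].
by move: ii; rewrite iu !inE (negbTE xu) (negbTE yu) (negbTE zu) (negbTE wu).
Qed.

Definition has_curve L := forall n, (n < 8)%N -> curve R n \in L.

(** A small moment curve at x meets the planes through three points of L in
    finitely many points. *)
Lemma perturb_point L x e : generic L -> has_curve L -> 0 < e ->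
  exists u, [/\ `|u - x| < e, u \notin L & generic (u :: L)].
Proof.
move=> gL cL e0.
(* with t <= 1 the powers of t are at most t *)
pose e1 := Num.min e 1.
have e10 : 0 < e1 by rewrite lt_min e0 ltr01.
have curve_uniq : uniq [seq curve R n | n <- iota 0 8].
  by rewrite map_inj_uniq ?iota_uniq //; apply: curve_inj.
have fourth (s : seq point) : (size s < 8)%N -> exists2 n, (n < 8)%N & curve R n \notin s.
  move=> s8; have /allPn[u /mapP[n]] : ~~ all (mem s) [seq curve R n | n <- iota 0 8].
    apply/negP => /allP /(uniq_leq_size curve_uniq).
    by rewrite size_map size_iota leqNgt s8.
  by rewrite mem_iota => /andP[_ n8] -> ?; exists n.
pose T := [seq p <- [seq (xy, z) | xy <- [seq (x, y) | x <- L, y <- L], z <- L]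
             | uniq [:: p.1.1; p.1.2; p.2]].
pose Q := \prod_(p <- T) vol_poly p.1.1 p.1.2 p.2 x.
have mem_T a b c : {subset [:: a; b; c] <= L} -> uniq [:: a; b; c] -> (a, b, c) \in T.
  move=> s un; rewrite mem_filter un /=.
  apply/allpairsP; exists ((a, b), c); split=> //=; last by apply: s; rewrite !inE eqxx !orbT.
  by apply/allpairsP; exists (a, b); split=> //=; apply: s; rewrite !inE eqxx ?orbT.
have Q0 : Q != 0.
  rewrite /Q prodf_seq_neq0; apply/allP => -[[a b] c]; rewrite mem_filter /=.
  move=> /andP[un /allpairsP[[[a' b'] c'] [/= + cL']]] [ea eb ec].
  move=> /allpairsP[[a'' b''] [/= aL bL]] [ea' eb']; subst.
  have [n n8 nN] := fourth [:: a''; b''; c'] isT.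
  apply: (@vol_poly_neq0 _ _ _ _ (curve R n)); apply: gL.
    by move=> i; rewrite !inE => /or4P[]/eqP-> //; apply: cL.
  by rewrite -(rot_uniq 3) /= nN.
have [t /andP[t0 te1] tQ] := small_nonroot Q0 e10.
have [te t1] : t < e /\ t <= 1.
  by move: te1; rewrite lt_min => /andP[-> /ltW].
pose u := x + \row_(i < 3) t ^+ i.+1.
have vu a b c : {subset [:: a; b; c] <= L} -> uniq [:: a; b; c] -> vol a b c u != 0.
  move=> s un; rewrite -vol_polyE; move: tQ; rewrite /root /Q horner_prod.
  by rewrite prodf_seq_neq0 => /allP/(_ _ (mem_T a b c s un)).
exists u; split.
- rewrite /u [x + _]addrC addrK; apply: row_norm_lt => // i; rewrite mxE ger0_norm ?exprn_ge0 ?ltW //.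
  by apply: le_lt_trans te; rewrite exprS ler_piMr ?exprn_ile1 // (ltW t0).
- apply/negP => uL.
  have [n n8 nu] := fourth [:: u] isT.
  have [m m8 mu] := fourth [:: u; curve R n] isT.
  have : vol u (curve R n) (curve R m) u != 0.
    apply: vu; first by move=> i; rewrite !inE => /or3P[]/eqP->; rewrite ?cL.
    move: nu mu; rewrite /= !inE !negb_or => nu /andP[mu mn].
    by rewrite (eq_sym (curve R n)) !(eq_sym u) nu mu mn.
  by rewrite (_ : vol _ _ _ _ = 0) ?eqxx // /vol /det3 !mxE; ring.
- exact: generic_cons.
Qed.

(** The points of X are moved by a map, so that coincidences, hence the ends of
    chains and their being closed, are preserved. *)
Lemma perturb L X e : generic L -> has_curve L -> 0 < e ->
  exists pi : point -> point, [/\ {in X &, injective pi},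
    forall x, x \in X -> `|pi x - x| < e,
    forall x, x \in X -> pi x \notin L & generic (map pi X ++ L)].
Proof.
move=> gL cL e0; elim: X => [|x X [pi [inj near avoid gX]]].
  by exists id; split.
have [xX|xX] := boolP (x \in X).
  have sub : {subset x :: X <= X} by move=> i; rewrite inE => /orP[/eqP->|].
  exists pi; split.
  - by move=> i j /sub iX /sub jX; apply: inj.
  - by move=> i /sub /near.
  - by move=> i /sub /avoid.
  - move=> a b c d s; apply: gX => i /s; rewrite inE => /orP[/eqP->|//].
    by rewrite mem_cat map_f.
have [] := @perturb_point (map pi X ++ L) x e gX _ e0.
  by move=> n n8; rewrite mem_cat cL ?orbT.
move=> u [ux uN gu]; pose pi' i := if i == x then u else pi i.
have pi'X i : i \in X -> pi' i = pi i.
  by move=> iX; rewrite /pi'; case: eqP xX => // <-; rewrite iX.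
have pi'x : pi' x = u by rewrite /pi' eqxx.
have uX i : i \in X -> pi i != u.
  by move=> iX; apply: contra uN => /eqP <-; rewrite mem_cat map_f.
exists pi'; split.
- move=> i j; rewrite !inE => /orP[/eqP->|iX] /orP[/eqP->|jX] //;
    rewrite ?pi'x ?pi'X //.
  + by move=> /esym/eqP; rewrite (negbTE (uX _ jX)).
  + by move=> /eqP; rewrite (negbTE (uX _ iX)).
  + exact: inj.
- by move=> i; rewrite inE => /orP[/eqP->|iX]; rewrite ?pi'x ?pi'X // near.
- move=> i; rewrite inE => /orP[/eqP->|iX]; rewrite ?pi'x ?pi'X ?avoid //.
  by apply: contra uN; rewrite mem_cat => ->; rewrite orbT.
- by have /eq_in_map eqX := pi'X; rewrite /= pi'x eqX.
Qed.

End Perturbation.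

(** * A chain that shrinks to a point away from another chain *)

Lemma ord3P (P : 'I_3 -> Prop) : P 0 -> P 1 -> P 2 -> forall i, P i.
Proof.
move=> P0 P1 P2 [[|[|[|//]]] p].
- by rewrite (_ : Ordinal p = 0) //; apply: val_inj.
- by rewrite (_ : Ordinal p = 1) //; apply: val_inj.
- by rewrite (_ : Ordinal p = 2) //; apply: val_inj.
Qed.

Section Shrinking. Variable R : realType.
Local Notation point := 'rV[R]_3.
Implicit Types (x y z w : point) (L X : seq point) (A B : seq (point * point)).

(** The common point is within r of x, being a convex combination of x, y and
    z, and within r of c. *)
Lemma common_point_close (u0 u1 u2 v0 v1 r : R) x y z c d :
  0 <= u1 -> 0 <= u2 -> 0 <= v1 -> 0 < u0 + u1 + u2 -> u0 + u1 + u2 = v0 + v1 ->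
  0 <= u0 -> 0 <= v0 ->
  u0 *: x + u1 *: y + u2 *: z = v0 *: c + v1 *: d ->
  `|x - y| <= r -> `|x - z| <= r -> `|c - d| <= r -> `|x - c| <= 2 * r.
Proof.
move=> u1_ge0 u2_ge0 v1_ge0 s_gt0 sE u0_ge0 v0_ge0 comb xy xz cd.
rewrite -(ler_pM2l s_gt0) -[X in X * _ <= _]gtr0_norm // -normrZ.
have -> : (u0 + u1 + u2) *: (x - c) = u1 *: (x - y) + u2 *: (x - z) - v1 *: (c - d).
  have -> : u1 *: (x - y) + u2 *: (x - z) - v1 *: (c - d) =
     (u0 + u1 + u2) *: x - (u0 *: x + u1 *: y + u2 *: z) - v1 *: c + v1 *: d.
    by apply/rowP => i; rewrite !mxE; ring.
  by rewrite comb scalerBr [in LHS]sE; apply/rowP => i; rewrite !mxE sE; ring.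
have nZ a (w : point) : 0 <= a -> `|w| <= r -> `|a *: w| <= a * r.
  by move=> a0 wr; rewrite normrZ ger0_norm // ler_wpM2l.
apply: le_trans (ler_normB _ _) _.
apply: le_trans (lerD (ler_normD _ _) (nZ _ _ v1_ge0 cd)) _.
apply: le_trans (lerD (lerD (nZ _ _ u1_ge0 xy) (nZ _ _ u2_ge0 xz)) (lexx _)) _.
have r0 : 0 <= r by apply: le_trans xy.
rewrite -!mulrDl mulrA ler_wpM2r //; lra.
Qed.

Lemma pierced_close r x y z c d : pierced x y z c d ->
  `|x - y| <= r -> `|x - z| <= r -> `|c - d| <= r -> `|x - c| <= 2 * r.
Proof.
have comb : vol y z c d *: x + (- vol x z c d) *: y + vol x y c d *: z =
   vol x y z d *: c + (- vol x y z c) *: d.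
  by apply/rowP; apply: ord3P; rewrite /vol /det3 !mxE; ring.
have sumE : vol y z c d + (- vol x z c d) + vol x y c d =
   vol x y z d + (- vol x y z c) by rewrite /vol /det3 !mxE; ring.
move=> pierced_xyz; move: comb sumE pierced_xyz; rewrite /pierced /alike /pos.
move: (vol y z c d) (vol x z c d) (vol x y c d) (vol x y z d) (vol x y z c).
move=> u0 u1 u2 v0 v1 comb sumE /and4P[].
case: (ltP 0 u0) => h0; case: (ltP 0 u1) => h1; case: (ltP 0 u2) => h2 //;
case: (ltP 0 v0) => h3; case: (ltP 0 v1) => h4 // _ _ _ _.
- by move=> xy xz cd; apply: (@common_point_close u0 (- u1) u2 v0 (- v1) r x y z c d);
    first [exact: comb|by []|lra].
- move=> xy xz cd.
  have comb' : (- u0) *: x + u1 *: y + (- u2) *: z = (- v0) *: c + v1 *: d.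
    by move/(congr1 (fun w => - w)): comb; rewrite !opprD -!scaleNr !opprK.
  by apply: (@common_point_close (- u0) u1 (- u2) (- v0) v1 r x y z c d);
    first [exact: comb'|by []|lra].
Qed.

Fixpoint segs x (s : seq point) : seq (point * point) :=
  if s is y :: s' then (x, y) :: segs y s' else [::].

Lemma segs_bounds x s : bounds (segs x s) x (last x s).
Proof.
elim: s x => [|y s IH] x phi /=; first by rewrite big_nil addbb.
by rewrite big_cons IH /=; case: (phi x) (phi y) (phi (last y s)) => [] [] [].
Qed.

Lemma segs_fst x s t : t \in segs x s -> t.1 \in x :: s /\ t.2 \in x :: s.
Proof.
elim: s x => //= y s IH x; rewrite inE => /orP[/eqP-> /=|/IH[t1 t2]].
  by split; rewrite !inE eqxx ?orbT.
by split; rewrite in_cons ?t1 ?t2 orbT.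
Qed.

Lemma ends_segs x s u : u \in ends (segs x s) -> u \in x :: s.
Proof. by rewrite mem_cat => /orP[] /mapP[t /segs_fst[t1 t2] ->]. Qed.

Lemma segs_ends x s : s != [::] -> x \in ends (segs x s) /\ last x s \in ends (segs x s).
Proof.
case: s => // y s _; split; first by rewrite mem_cat inE eqxx.
elim: s x y => [|z s IH] x y; first by rewrite !inE /= eqxx orbT.
move: (IH y z); rewrite /= mem_cat => /orP[] h; rewrite mem_cat;
  apply/orP; [left|right]; by rewrite inE h orbT.
Qed.

Lemma ends_push pi A : ends (push pi A) = map pi (ends A).
Proof. by rewrite /ends map_cat /unzip1 /unzip2 -!map_comp. Qed.

Lemma push_cat pi A B : push pi (A ++ B) = push pi A ++ push pi B.
Proof. exact: map_cat. Qed.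

Lemma push_bounds pi A x y : bounds A x y -> bounds (push pi A) (pi x) (pi y).
Proof. by move=> bA phi; rewrite big_map (bA (phi \o pi)). Qed.

(** The images of A0 under the maps G k, moved into general position, are
    successive polygons between A0 and a constant chain.  All triangles between
    two successive polygons are small and far from B0, so they are not pierced.
    The distance 8 r leaves room for the perturbation of both chains and for
    the diameters of the triangle and the segment. *)
Lemma null_crossing L (e : point) (pi : point -> point) A0 B0 (G : nat -> point -> point) n c r :
  generic L -> has_curve L -> 0 < r -> closed_chain A0 -> closed_chain B0 ->
  placed L e (push pi A0) (push pi B0) ->
  {in ends A0 ++ ends B0, forall x, `|pi x - x| < r} ->
  {in ends A0, forall x, G 0 x = x} ->
  {in ends A0, forall x, G n x = c} ->
  {in A0, forall s k, (k < n)%N -> [/\ `|G k s.1 - G k s.2| < r,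
     `|G k s.1 - G k.+1 s.2| < r & `|G k s.1 - G k.+1 s.1| < r]} ->
  {in B0, forall t, `|t.1 - t.2| < r} ->
  {in ends A0 & ends B0, forall x y k, (k <= n)%N -> 8 * r < `|G k x - y|} ->
  crossing e (push pi A0) (push pi B0) = false.
Proof.
move=> gL cL r0 cA cB pl near G0 Gn meshA meshB far.
pose X := [seq G k x | k <- iota 1 n, x <- ends A0].
have [pi' [_ near' avoid' gL']] := perturb X gL cL r0.
pose L' := map pi' X ++ L.
(* the first polygon is the given push of A0, the others get new positions *)
pose g k x := if k is k'.+1 then pi' (G k x) else pi x.
have gX k x : x \in ends A0 -> (0 < k <= n)%N -> G k x \in X.
  move=> xA /andP[k0 kn]; apply/allpairsP; exists (k, x); split=> //=.
  by rewrite mem_iota k0.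
have g_near k x : x \in ends A0 -> (k <= n)%N -> `|g k x - G k x| < r.
  case: k => [|k] xA kn; first by rewrite G0 // near // mem_cat xA.
  by apply: near'; apply: gX.
have subL : {subset L <= L'} by move=> i iL; rewrite mem_cat iL orbT.
have plk k : (k <= n)%N -> placed L' e (push (g k) A0) (push pi B0).
  case: pl => _ sub eA eB dis kn.
  have BL u : u \in ends (push pi B0) -> u \in L.
    by move=> uB; apply: sub; rewrite inE mem_cat uB !orbT.
  have eL : e \in L by apply: sub; rewrite inE eqxx.
  case: k kn => [|k] kn.
    by split=> // i /sub; apply: subL.
  have gL1 u : u \in ends (push (g k.+1) A0) -> u \in L' /\ u \notin L.
    rewrite ends_push => /mapP[x xA ->] /=; have Gx := gX k.+1 _ xA kn.
    by split; [rewrite mem_cat map_f|apply: avoid'].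
  split=> //.
  - move=> i; rewrite inE mem_cat => /or3P[/eqP->|/gL1[]//|/BL/subL//].
    exact: subL.
  - by apply/negP => /gL1[_]; rewrite eL.
  - by move=> u /gL1[_ uL]; apply: contra uL; apply: BL.
have step k : (k < n)%N ->
    crossing e (push (g k) A0) (push pi B0) = crossing e (push (g k.+1) A0) (push pi B0).
  move=> kn; have kn' := ltnW kn.
  have nopierced s y : s \in A0 -> forall z,
      `|G k s.1 - y| < r -> `|G k s.1 - z| < r -> forall y' z',
      `|y' - y| < r -> `|z' - z| < r -> piercings (g k s.1) y' z' (push pi B0) = false.
    move=> sA z ky kz y' z' yy zz; rewrite /piercings big_map big_seq big1 // => t tB.
    apply/negP => /= /(pierced_close (r := 3 * r)) close.
    have sk := g_near _ _ (ends1 sA) kn'.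
    have t1 : `|pi t.1 - t.1| < r by apply: near; rewrite mem_cat (ends1 tB) ?orbT.
    have t2 : `|pi t.2 - t.2| < r by apply: near; rewrite mem_cat (ends2 tB) ?orbT.
    have tri (a a' b b' : point) : `|a' - a| < r -> `|b' - b| < r -> `|a - b| < r -> `|a' - b'| <= 3 * r.
      move=> aa bb ab; rewrite (_ : a' - b' = (a' - a) + (a - b) - (b' - b)).
        apply: le_trans (ler_normB _ _) _; apply: le_trans (lerD (ler_normD _ _) (lexx _)) _.
        by apply: le_trans (lerD (lerD (ltW aa) (ltW ab)) (ltW bb)) _; lra.
      by apply/rowP => i; rewrite !mxE; ring.
    have := close (tri _ _ _ _ sk yy ky) (tri _ _ _ _ sk zz kz) (tri _ _ _ _ t1 t2 (meshB _ tB)).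
    have := far _ _ (ends1 sA) (ends1 tB) k kn'.
    have : `|G k s.1 - t.1| <= `|g k s.1 - pi t.1| + `|pi t.1 - t.1| + `|g k s.1 - G k s.1|.
      rewrite -[X in X <= _]normrN opprB.
      have -> : t.1 - G k s.1 = - (g k s.1 - pi t.1) - (pi t.1 - t.1) + (g k s.1 - G k s.1).
        by apply/rowP => i; rewrite !mxE; ring.
      apply: le_trans (ler_normD _ _) _; rewrite lerD2r.
      by apply: le_trans (ler_normB _ _) _; rewrite normrN.
    lra.
  apply: (crossing_homotopy gL') => //.
  - exact: push_closed.
  - exact: plk.
  - exact: plk.
  - move=> s sA; have [m1 m2 m3] := meshA _ sA _ kn.
    by apply: (nopierced _ _ sA _ m1 m2); apply: g_near => //; [apply: ends2|apply: ends2].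
  - move=> s sA; have [m1 m2 m3] := meshA _ sA _ kn.
    by apply: (nopierced _ _ sA _ m3 m2); apply: g_near => //; [apply: ends1|apply: ends2].
have all_eq k : (k <= n)%N ->
    crossing e (push pi A0) (push pi B0) = crossing e (push (g k) A0) (push pi B0).
  elim: k => [//|k IH] kn.
  by rewrite (IH (ltnW kn)); apply: step.
rewrite (all_eq n (leqnn n)).
rewrite /crossing big_map big_seq big1 // => s sA.
have -> : g n s.1 = g n s.2.
  have [s1 s2] := (ends1 sA, ends2 sA).
  case: (n) Gn => [|m] Gn /=; last by rewrite !Gn.
  by rewrite -[s.1]G0 // -[s.2]G0 // !Gn.
by rewrite /piercings big1 // => t _; apply: pierced_xyy.
Qed.
End Shrinking.

(** * Compactness, connectedness and the two sides of the unit sphere *)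

Local Open Scope classical_set_scope.

Section UnitSphere. Variable R : realType.
Local Notation point := 'rV[R]_3.
Implicit Types (x y z w : point) (L X : seq point) (A B : seq (point * point)) (K S : set point).

(** A property that holds near every point of the diagonal of a compact set
    holds uniformly near it. *)
Lemma compact_uniform (P : point -> point -> Prop) K : compact K ->
  (forall x, K x -> exists2 e, 0 < e &
     forall x' y, `|x - x'| < e -> `|x - y| < e -> P x' y) ->
  exists2 d, 0 < d & forall x y, K x -> `|x - y| < d -> P x y.
Proof.
move=> /compact_near_coveringP cK loc.
have := cK R (0^'+) (fun d x => forall y, `|x - y| < d -> P x y) _.
case.
  move=> x Kx; have [e e0 Pe] := loc x Kx.
  have e20 : 0 < e / 2 by lra.
  exists (ball x (e / 2), [set d | d < e / 2]) => /=.
    split; first exact: nbhsx_ballx.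
    by apply: nbhs_right_lt.
  move=> [x' d] /= [+ de] y x'y; rewrite -ball_normE /= => xx'.
  apply: Pe; first by lra.
  rewrite (_ : x - y = (x - x') + (x' - y)); last by rewrite addrA addrNK.
  apply: le_lt_trans (ler_normD _ _) _.
  lra.
move=> d /= d0 H.
exists (d / 2) => //; first by lra.
move=> x y Kx xy; apply: (H (d / 2)) => //=; last by lra.
by rewrite sub0r normrN gtr0_norm; lra.
Qed.

Lemma compact_uniform_continuous (f : point -> point) K e : continuous f -> compact K ->
  0 < e -> exists2 d, 0 < d & forall x y, K x -> `|x - y| < d -> `|f x - f y| < e.
Proof.
move=> cf cK e0; apply: compact_uniform => // x Kx.
have e20 : 0 < e / 2 by lra.
have /cvgrPdist_lt/(_ _ e20)/nbhs_ballP[d /= d0 H] := cf x.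
exists d => // x' y xx' xy.
have h1 : `|f x - f x'| < e / 2 by apply: H; rewrite -ball_normE.
have h2 : `|f x - f y| < e / 2 by apply: H; rewrite -ball_normE.
rewrite (_ : f x' - f y = (f x - f y) - (f x - f x')); last by apply/rowP => i; rewrite !mxE; ring.
apply: le_lt_trans (ler_normB _ _) _; lra.
Qed.

Lemma compact_distance K S : compact K -> compact S -> K `&` S = set0 ->
  exists2 d, 0 < d & forall x y, K x -> S y -> d <= `|x - y|.
Proof.
move=> cK cS KS.
have [|d d0 H] := @compact_uniform (fun _ y => ~ S y) K cK.
  move=> x Kx; have : nbhs x (~` S).
    apply: open_nbhs_nbhs; split; last by move=> Sx; rewrite -[False]/(set0 x) -KS.
    by apply: closed_openC; apply: compact_closed => //; exact: norm_hausdorff.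
  move=> /nbhs_ballP[e /= e0 eS]; exists e => // x' y _ xy.
  by apply: eS; rewrite -ball_normE.
exists d => // x y Kx Sy; rewrite leNgt; apply/negP => xy.
exact: (H x y Kx xy Sy).
Qed.

(** The points that are reached from x by steps smaller than e form a subset
    of K that is separated from its complement in K. *)
Lemma connected_chain K x y e : connected K -> K x -> K y -> 0 < e ->
  exists s : seq point, [/\ last x s = y, forall z, z \in x :: s -> K z &
    forall t, t \in segs x s -> `|t.1 - t.2| < e].
Proof.
move=> cK Kx Ky e0.
pose reach z := exists s : seq point, [/\ last x s = z, forall w, w \in x :: s -> K w &
    forall t, t \in segs x s -> `|t.1 - t.2| < e].
have segs_rcons z s (w : point) : segs z (rcons s w) = rcons (segs z s) (last z s, w).
  by elim: s z => //= a s IH z; rewrite IH.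
have reach_step z w : reach z -> K w -> `|z - w| < e -> reach w.
  move=> [s [<- sK se]] Kw zw; exists (rcons s w); split.
  - by rewrite last_rcons.
  - by move=> i; rewrite -rcons_cons mem_rcons inE => /orP[/eqP->//|/sK].
  - by move=> t; rewrite segs_rcons mem_rcons inE => /orP[/eqP->//|/se].
have reachK z : reach z -> K z by move=> [s [<- + _]]; apply; apply: mem_last.
apply: contrapT => nreach.
pose E (b : bool) := if b then K `&` ~` [set z | reach z] else [set z | reach z].
apply: ((connectedP K).1 cK E); split.
- case; first by exists y.
  by exists x; exists [::]; split=> // z; rewrite inE => /eqP->.
- apply/seteqP; split=> [z Kz|z [/reachK//|[]//]].
  by have [rz|nz] := pselect (reach z); [left|right].
- split; apply/seteqP; split=> z //.
  + move=> [clz [Kz nz]]; apply: nz.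
    have [w [rw /= zw]] := clz _ (nbhsx_ballx z e e0).
    apply: (reach_step w) => //.
    by rewrite -ball_normE /= in zw; rewrite distrC.
  + move=> [rz clz].
    have [w [[Kw nw] /= zw]] := clz _ (nbhsx_ballx z e e0).
    by apply: nw; apply: (reach_step z) => //; rewrite -ball_normE /= in zw.
Qed.

Definition sqnorm x := \sum_i x 0 i ^+ 2.

Lemma sqnorm3 x : sqnorm x = x 0 0 ^+ 2 + x 0 1 ^+ 2 + x 0 2 ^+ 2.
Proof.
rewrite /sqnorm !big_ord_recl big_ord0 addr0 addrA.
by congr (_ ^+ 2 + _ ^+ 2 + _ ^+ 2); congr (x 0 _); apply: val_inj.
Qed.

Lemma sqnormZ a x : sqnorm (a *: x) = a ^+ 2 * sqnorm x.
Proof. by rewrite !sqnorm3 !mxE; ring. Qed.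

Lemma sqnorm_ge0 x : 0 <= sqnorm x.
Proof. by apply: sumr_ge0 => i _; apply: sqr_ge0. Qed.

Lemma sqnorm_continuous : continuous sqnorm.
Proof.
move=> x; rewrite (_ : sqnorm = (fun y => y 0 0 ^+ 2 + y 0 1 ^+ 2 + y 0 2 ^+ 2)).
  have sq i : (fun y : point => y 0 i ^+ 2) @ x --> x 0 i ^+ 2.
    have c := @coord_continuous R 1 3 0 i x.
    exact: (cvgM c c).
  exact: (cvgD (cvgD (sq 0) (sq 1)) (sq 2)).
by apply/funext => y; exact: sqnorm3.
Qed.

Lemma norm_le1 x : sqnorm x <= 1 -> `|x| <= 1.
Proof.
move=> x1; apply/ler_addgt0Pr => e e0; apply/ltW/row_norm_lt; first by lra.
move=> i; apply: le_lt_trans (_ : 1 < _); last by lra.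
have : x 0 i ^+ 2 <= 1.
  by apply: le_trans x1; rewrite /sqnorm (bigD1 i) //= lerDl sumr_ge0 // => j _; apply: sqr_ge0.
by move=> h; rewrite ler_norml; apply/andP; split; nra.
Qed.

Definition unit_ball : set point := [set x | sqnorm x <= 1].

Lemma unit_ball_compact : compact unit_ball.
Proof.
apply: bounded_closed_compact.
  exists 1; split=> // M M1 x /norm_le1 x1; apply: le_trans x1 (ltW M1).
rewrite (_ : unit_ball = sqnorm @^-1` [set a | a <= 1]) //.
by apply: closed_comp; [move=> x _; exact: sqnorm_continuous|exact: closed_le].
Qed.

Lemma segment_component S x y : segment x y `<=` S -> connected_component S x y.
Proof.
move=> xyS.
exists (segment x y).
  split=> //.
    by exists 0 => /=; [rewrite in_itv /= lexx ler01|rewrite subr0 scale1r scale0r addr0].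
  apply: connected_continuous_connected; first exact: segment_connected.
  apply: continuous_subspaceT => t.
  by apply: cvgD; apply: cvgZr_tmp; [apply: cvgB; [exact: cvg_cst|exact: cvg_id]|exact: cvg_id].
by exists 1 => /=; [rewrite in_itv /= lexx ler01|rewrite subrr scale1r scale0r add0r].
Qed.

Lemma inside_component x y : sqnorm x < 1 -> sqnorm y < 1 ->
  connected_component [set z | sqnorm z < 1] x y.
Proof.
have to0 z : sqnorm z < 1 -> connected_component [set z | sqnorm z < 1] z 0.
  move=> z1; apply: segment_component => _ [t /= /[!in_itv] /= /andP[t0 t1] <-].
  rewrite scaler0 addr0 sqnormZ; apply: le_lt_trans z1.
  by rewrite ler_piMl ?sqnorm_ge0 //; nra.
move=> /to0 x0 /to0 y0; apply: connected_component_trans x0 _.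
exact: connected_component_sym.
Qed.

Definition exterior : set point := [set z | 1 < sqnorm z].

(** From a point outside the ball one moves radially until a coordinate
    exceeds 1 in absolute value.  The half-spaces where a given coordinate is
    larger than 1, or smaller than -1, are convex and lie outside the ball, and
    half-spaces for different coordinates meet. *)
Lemma exterior_component x y : 1 < sqnorm x -> 1 < sqnorm y ->
  connected_component exterior x y.
Proof.
have coord_exterior i z : 1 < z 0 i ^+ 2 -> exterior z.
  move=> zi; rewrite /exterior /= /sqnorm (bigD1 i) //=.
  by rewrite (lt_le_trans zi) // lerDl sumr_ge0 // => j _; apply: sqr_ge0.
have axis i (s : R) z w : s ^+ 2 = 1 -> 1 < s * z 0 i -> 1 < s * w 0 i ->
    connected_component exterior z w.
  move=> s1 zi wi; apply: segment_component => _ [t /= /[!in_itv] /= /andP[t0 t1] <-].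
  apply: (coord_exterior i); rewrite !mxE.
  have h : 1 < s * ((1 - t) * z 0 i + t * w 0 i).
    have -> : s * ((1 - t) * z 0 i + t * w 0 i) =
      (1 - t) * (s * z 0 i) + t * (s * w 0 i) by ring.
    move: (s * z 0 i) (s * w 0 i) zi wi => a b a1 b1.
    by case: (leP a b) => ab; [apply: (lt_le_trans a1)|apply: (lt_le_trans b1)]; nra.
  have <- : (s * ((1 - t) * z 0 i + t * w 0 i)) ^+ 2 = ((1 - t) * z 0 i + t * w 0 i) ^+ 2.
    by rewrite exprMn s1 mul1r.
  nra.
pose two : point := const_mx 2.
have to2 z : exterior z -> connected_component exterior z two.
  move=> ez; have [i zi0] : exists i, z 0 i != 0.
    apply: contrapT => nz; move: ez; rewrite /exterior /= /sqnorm big1 ?ltr10 // => i _.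
    by apply/eqP; rewrite sqrf_eq0; apply: contrapT => /negP zi; apply: nz; exists i.
  pose s := Num.sg (z 0 i); have s1 : s ^+ 2 = 1 by rewrite sqr_sg zi0.
  have sz : s * z 0 i = `|z 0 i| by rewrite [RHS]normrEsg.
  have zi : 0 < `|z 0 i| by rewrite normr_gt0.
  (* a z is beyond 1 in the direction of its i-th axis *)
  pose a := 1 + 2 / `|z 0 i|.
  have a_big : 1 < s * (a *: z) 0 i.
    rewrite !mxE mulrCA sz /a mulrDl mul1r divfK ?gt_eqF //; lra.
  have a1 : 1 <= a by rewrite lerDl divr_ge0 // ltW.
  apply: (@connected_component_trans _ _ (a *: z)).
    apply: segment_component => _ [t /= /[!in_itv] /= /andP[t0 t1] <-].
    rewrite scalerA -scalerDl /exterior /= sqnormZ.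
    have : 1 <= 1 - t + t * a by nra.
    move: ez; rewrite /exterior /=; move: (sqnorm z) (1 - t + t * a) => u v u1 v1.
    apply: (lt_le_trans u1); rewrite ler_peMl //; first [lra|nra].
  have [j ji] : exists j : 'I_3, j != i.
    by case: (eqVneq i 0) => [->|]; [exists 1|exists 0; rewrite eq_sym].
  (* w is in the half-spaces of a z and of two *)
  pose w : point := \row_k (if k == i then 2 * s else 2).
  apply: (@connected_component_trans _ _ w).
    by apply: (axis i s) => //; rewrite mxE eqxx mulrCA -expr2 s1; lra.
  apply: (axis j 1); first by rewrite expr1n.
    by rewrite mul1r mxE (negbTE ji); lra.
  by rewrite mul1r mxE; lra.
move=> /to2 x2 /to2 y2; apply: connected_component_trans x2 _.
exact: connected_component_sym.
Qed.

Lemma image_component (h : point -> point) S T x y : continuous h ->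
  connected_component S x y -> (forall z, S z -> T (h z)) ->
  connected_component T (h x) (h y).
Proof.
move=> ch [C [Cx CS cC] Cy] ST; exists (h @` C); last by exists y.
split; first by exists x.
  by move=> _ [z /CS/ST Tz <-].
apply: connected_continuous_connected => //.
exact: continuous_subspaceT.
Qed.

End UnitSphere.

(** * Split curves have linking number zero *)

Section SplitLinks. Variable R : realType.
Local Notation point := 'rV[R]_3.
Implicit Types (x y z w : point) (L X : seq point) (A B : seq (point * point)) (K S : set point).
Implicit Types (h g pi : point -> point).

(** A closed chain with vertices in K and short edges stands for a polygon
    inscribed in the curve K. *)
Definition fine_loop K e A := [/\ closed_chain A, forall x, x \in ends A -> K x &
  forall s, s \in A -> `|s.1 - s.2| < e].

(** The cone contraction of the ball, transported by h, shrinks the first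
    curve to a point inside the image of the closed ball, which is compact and
    disjoint from KB. *)
Lemma inside_unlinked h g KA KB : continuous h -> continuous g -> cancel h g ->
  cancel g h -> compact KA -> compact KB ->
  (forall x, KA x -> sqnorm (g x) < 1) -> (forall x, KB x -> 1 < sqnorm (g x)) ->
  exists2 d, 0 < d & forall L e pi A B, generic L -> has_curve L ->
    fine_loop KA d A -> fine_loop KB d B ->
    {in ends A ++ ends B, forall x, `|pi x - x| < d} ->
    placed L e (push pi A) (push pi B) ->
    crossing e (push pi A) (push pi B) = false.
Proof.
move=> ch cg hK gK cKA cKB insA outB.
have cD : compact (h @` @unit_ball R).
  apply: continuous_compact; last exact: unit_ball_compact.
  exact: continuous_subspaceT.
have [|d0 d0_gt0 far] := compact_distance cD cKB.
  rewrite -subset0 => _ [[u u1 <-] /outB]; rewrite hK /unit_ball /= in u1 *.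
  by rewrite ltNge u1.
pose r := d0 / 9; have r0 : 0 < r by rewrite /r; lra.
have [eta eta0 h_unif] := compact_uniform_continuous ch (@unit_ball_compact R) r0.
have eta20 : 0 < eta / 2 by lra.
have [d d_gt0 g_unif] := compact_uniform_continuous cg cKA eta20.
(* the number of steps of the discrete contraction *)
pose n := (Num.bound (2 / eta)).+1.
have n_gt0 : 0 < n%:R :> R by rewrite ltr0n.
have n_big : n%:R^-1 < eta / 2.
  rewrite -[ltRHS]invrK ltf_pV2 ?posrE ?invr_gt0 // invf_div.
  by apply: lt_trans (archi_boundP _) _; rewrite ?ltr_nat ?divr_ge0 ?ltW.
exists (Num.min d r); first by rewrite lt_min d_gt0.
move=> L e pi A B gL cL [cA AK mA] [cB BK mB] near pl.
pose G (k : nat) x := h ((1 - k%:R / n%:R) *: g x).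
have ball_in (a : R) x : KA x -> 0 <= a <= 1 -> unit_ball (a *: g x).
  move=> Kx /andP[a0 a1]; rewrite /unit_ball /= sqnormZ.
  have := insA x Kx; have := sqnorm_ge0 (g x); nra.
have coef k : (k <= n)%N -> ((0 : R) <= 1 - k%:R / n%:R :> R) && (1 - k%:R / n%:R <= 1 :> R).
  move=> kn; rewrite subr_ge0 ler_pdivrMr // mul1r ler_nat kn /=.
  by rewrite gerBl divr_ge0 // ler0n.
have gnorm x : KA x -> `|g x| <= 1 by move=> /insA/ltW/norm_le1.
have G_close k l x y : (k <= l <= k.+1)%N -> (l <= n)%N -> KA x -> KA y -> `|x - y| < d ->
    `|G k x - G l y| < r.
  move=> /andP[kl lk] ln Kx Ky xy; apply: h_unif; first by apply/ball_in/coef/(leq_trans kl).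
  rewrite (_ : _ - _ = (1 - k%:R / n%:R) *: (g x - g y) + ((l%:R - k%:R) / n%:R) *: g y).
    apply: le_lt_trans (ler_normD _ _) _; rewrite !normrZ.
    have gxy := g_unif _ _ Kx xy; have gy := gnorm _ Ky.
    have /andP[c0 c1] := coef k (leq_trans kl ln).
    have lk0 : 0 <= (l%:R - k%:R) / n%:R :> R by rewrite divr_ge0 ?ler0n // subr_ge0 ler_nat.
    have lkn : (l%:R - k%:R) / n%:R <= n%:R^-1 :> R.
      by rewrite ler_piMl ?invr_ge0 ?ler0n // lerBlDr -[1]/(1%:R) -natrD ler_nat add1n.
    rewrite (ger0_norm c0) -[`|_ - k%:R| * _]normrM (ger0_norm lk0).
    have p1 := ler_wpM2r (normr_ge0 (g x - g y)) c1.
    have p2 := ler_pM lk0 (normr_ge0 (g y)) lkn gy.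
    by rewrite mul1r in p1; rewrite mulr1 in p2; lra.
  by apply/rowP => i; rewrite !mxE; ring.
have AKs s : s \in A -> KA s.1 /\ KA s.2.
  by move=> sA; split; apply: AK; [apply: ends1|apply: ends2].
apply: (@null_crossing _ L e pi A B G n (h 0) r) => //.
- by move=> x xin; apply: lt_le_trans (near x xin) _; rewrite ge_min lexx orbT.
- by move=> x xA; rewrite /G mul0r subr0 scale1r gK.
- by move=> x xA; rewrite /G divff ?gt_eqF // subrr scale0r.
- move=> s sA k kn; have [K1 K2] := AKs s sA.
  have sd : `|s.1 - s.2| < d by apply: lt_le_trans (mA s sA) _; rewrite ge_min lexx.
  split; apply: G_close; rewrite ?leqnn ?leqnSn ?kn ?(ltnW kn) //.
  by rewrite subrr normr0.
- by move=> t tB; apply: lt_le_trans (mB t tB) _; rewrite ge_min lexx orbT.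
- move=> x y xA yB k kn.
  have : d0 <= `|G k x - y|.
    apply: far; last exact: BK.
    by exists ((1 - k%:R / n%:R) *: g x) => //; apply: ball_in; [exact: AK|exact: coef].
  by apply: lt_le_trans; rewrite /r; lra.
Qed.

(** Both sides of the sphere are connected, so one of the two sets lies in the
    ball and the other one outside.  If it is the second set that lies in the
    ball, the symmetry of the linking number is used. *)
Lemma split_unlinked KA KB : compact KA -> compact KB -> KA !=set0 -> KB !=set0 ->
  split_link KA KB ->
  exists2 d, 0 < d & forall L pi A B, generic L -> has_curve L ->
    fine_loop KA d A -> fine_loop KB d B ->
    {in ends A ++ ends B, forall x, `|pi x - x| < d} ->
    placed L (curve R 0) (push pi A) (push pi B) ->
    placed L (curve R 7) (push pi A) (push pi B) ->
    crossing (curve R 0) (push pi A) (push pi B) = false.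
Proof.
move=> cKA cKB [a0 Aa0] [b0 Bb0] [S [[h [ch [g [cg hK gK]]] SE] dis sep]].
have notS x : (KA `|` KB) x -> sqnorm (g x) != 1.
  move=> ABx; apply/eqP => x1; suff : (set0 : set point) x by [].
  by rewrite -dis; split=> //; rewrite SE; exists (g x).
have compl z : sqnorm z != 1 -> (~` S) (h z).
  by move=> z1; rewrite SE => -[u u1 /(can_inj hK) uz]; rewrite -uz /sqnorm u1 eqxx in z1.
have not_inside x y : KA x -> KB y -> sqnorm (g x) < 1 -> 1 <= sqnorm (g y).
  move=> Ax By x1; rewrite leNgt; apply/negP => y1; apply: (sep x y Ax By).
  rewrite -[x]gK -[y]gK; apply: (image_component ch (inside_component x1 y1)).
  by move=> z /= z1; apply: compl; rewrite lt_eqF.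
have not_outside x y : KA x -> KB y -> 1 < sqnorm (g x) -> sqnorm (g y) <= 1.
  move=> Ax By x1; rewrite leNgt; apply/negP => y1; apply: (sep x y Ax By).
  rewrite -[x]gK -[y]gK; apply: (image_component ch (exterior_component x1 y1)).
  by move=> z /= z1; apply: compl; rewrite gt_eqF.
have [b_in|b_out] := ltP (sqnorm (g b0)) 1.
- have insB y : KB y -> sqnorm (g y) < 1.
    have outa : 1 < sqnorm (g a0).
      rewrite ltNge le_eqVlt negb_or notS /=; last by left.
      by apply/negP => /(not_inside _ _ Aa0 Bb0); rewrite leNgt b_in.
    by move=> By; rewrite lt_neqAle notS ?(not_outside a0) //; right.
  have outA x : KA x -> 1 < sqnorm (g x).
    move=> Ax; rewrite ltNge le_eqVlt negb_or notS /=; last by left.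
    by apply/negP => /(not_inside _ _ Ax Bb0); rewrite leNgt b_in.
  have [d d0 H] := inside_unlinked ch cg hK gK cKB cKA insB outA.
  exists d => // L pi A B gL cL fA fB near pl pl'.
  have [[cA _ _] [cB _ _]] := (fA, fB).
  rewrite (crossingC pl pl'); try exact: push_closed.
  + apply: (H L) => //; last exact: placedC.
    by move=> x; rewrite mem_cat orbC -mem_cat; apply: near.
  + by apply/eqP => /curve_inj.
- have outb : 1 < sqnorm (g b0).
    by rewrite lt_neqAle b_out eq_sym notS //; right.
  have insA x : KA x -> sqnorm (g x) < 1.
    move=> Ax; rewrite lt_neqAle notS /=; last by left.
    by rewrite leNgt; apply/negP => /(not_outside _ _ Ax Bb0); rewrite leNgt outb.
  have outB y : KB y -> 1 < sqnorm (g y).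
    move=> By; rewrite lt_neqAle eq_sym notS /=; last by right.
    exact: not_inside Aa0 By (insA _ Aa0).
  have [d d0 H] := inside_unlinked ch cg hK gK cKA cKB insA outB.
  by exists d => // L pi A B gL cL fA fB near pl _; apply: (H L).
Qed.
End SplitLinks.

(** * Realizations of edges and cycles *)

Section Graph. Variables (R : realType) (G : sgraph).
Local Notation point := 'rV[R]_3.
Implicit Types (u w : G) (e : {set G}) (C : {set {set G}}).

Lemma realizationS C C' : C \subset C' -> realization R C `<=` realization R C'.
Proof.
by move=> CC' p [p0 p1 [e eC pe]]; split=> //; exists e => //; apply: (fintype.subsetP CC').
Qed.

Lemma realization_disjoint C C' : vertex_disjoint C C' ->
  realization R C `&` realization R C' = set0.
Proof.
move=> dis; rewrite -subset0 => p [[p0 p1 [e eC pe]] [_ _ [e' eC' pe']]].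
have : \sum_v p v = 0.
  apply: big1 => v _; have [ve|/pe//] := boolP (v \in e).
  apply: pe'; apply/negP => ve'.
  have vC : v \in finset.cover C by apply/bigcupP; exists e.
  have := disjointFr dis vC; rewrite (_ : v \in _) //.
  by apply/bigcupP; exists e'.
by rewrite p1 => /eqP; rewrite oner_eq0.
Qed.

Definition edge_point u w (t : R) : {ptws G -> R} :=
  fun v => (1 - t) * (v == u)%:R + t * (v == w)%:R.

Lemma edge_point_continuous u w : continuous (edge_point u w).
Proof.
move=> t; apply/cvg_sup => v; apply/cvg_image.
  apply/seteqP; split=> // a _; exists (fun=> a : R) => //.
move=> V nV /=; exists ((fun p : {ptws G -> R} => p v) @^-1` V); last first.
  apply/seteqP; split=> [_ [p Vp <-] //|a Va]; exists (fun=> a : R) => //.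
have cv : (fun r : R => (1 - r) * (v == u)%:R + r * (v == w)%:R) @ t -->
    (1 - t) * (v == u)%:R + t * (v == w)%:R.
  apply: cvgD; (apply: cvgM; last exact: cvg_cst); last exact: cvg_id.
  by apply: cvgB; [exact: cvg_cst|exact: cvg_id].
exact: (cv V nV).
Qed.

Lemma realization_edge u w : u != w ->
  realization R [set [set u; w]]%SET = edge_point u w @` `[0, 1].
Proof.
move=> uw; apply/seteqP; split=> [p [p0 p1 [e]]|_ [t /= /[!in_itv] /= /andP[t0 t1] <-]].
  rewrite inE => /eqP-> pe; have pw : p u = 1 - p w.
    rewrite -p1 (bigD1 u) //= (bigD1 w) 1?eq_sym //= big1 ?addr0 ?addrK // => v /andP[vu vw].
    by apply: pe; rewrite !inE negb_or vu vw.
  exists (p w).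
    by rewrite /= in_itv /= p0 -subr_ge0 -pw p0.
  apply/funext => v; rewrite /edge_point -pw.
  have [->|vu] := eqVneq v u; first by rewrite (negbTE uw) mulr1 mulr0 addr0.
  have [->|vw] := eqVneq v w; first by rewrite mulr1 mulr0 add0r.
  by rewrite !mulr0 addr0 pe // !inE negb_or vu vw.
split.
- by move=> v; rewrite addr_ge0 // mulr_ge0 ?ler0n // subr_ge0.
- rewrite big_split /= -!mulr_sumr.
  have sum1 x : \sum_v (v == x)%:R = 1 :> R.
    by rewrite (bigD1 x) //= eqxx big1 ?addr0 // => v /negbTE->.
  by rewrite !sum1 !mulr1 subrK.
- exists [set u; w]%SET; first by rewrite inE.
  move=> v; rewrite !inE negb_or /edge_point => /andP[/negbTE-> /negbTE->].
  by rewrite !mulr0 addr0.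
Qed.

Lemma realization_compact C : C \subset edges G -> compact (realization R C).
Proof.
move=> CE; have -> : realization R C =
    \big[setU/set0]_(e <- enum C) realization R [set e]%SET.
  rewrite -bigcup_seq; apply/seteqP; split=> p.
    move=> [p0 p1 [e eC pe]]; exists e; first by rewrite /= mem_enum.
    by split=> //; exists e => //; rewrite inE.
  move=> [e /=]; rewrite mem_enum => eC; apply: realizationS.
  by rewrite finset.sub1set.
rewrite big_seq; apply: bigsetU_compact => e; rewrite mem_enum.
move=> /(fintype.subsetP CE)/imsetP[[u w]]; rewrite inE /= => uw ->.
have uw' : u != w by apply: contraTneq uw => ->; rewrite adj_irrefl.
rewrite realization_edge //; apply: continuous_compact; last exact: segment_compact.
by apply: continuous_subspaceT; apply: edge_point_continuous.
Qed.

Lemma edge_connected u w : u != w -> connected (realization R [set [set u; w]]%SET).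
Proof.
move=> uw; rewrite realization_edge //.
apply: connected_continuous_connected; first exact: segment_connected.
by apply: continuous_subspaceT; apply: edge_point_continuous.
Qed.

Lemma edge_point0 u w : u != w -> realization R [set [set u; w]]%SET (edge_point u w 0).
Proof. by move=> uw; rewrite realization_edge //; exists 0 => //=; rewrite in_itv /= lexx ler01. Qed.

Lemma edge_point1 u w : u != w -> realization R [set [set u; w]]%SET (edge_point u w 1).
Proof. by move=> uw; rewrite realization_edge //; exists 1 => //=; rewrite in_itv /= lexx ler01. Qed.

Definition vertex_point u : {ptws G -> R} := fun v => (v == u)%:R.

Lemma edge_point0E u w : edge_point u w 0 = vertex_point u.
Proof. by apply/funext => v; rewrite /edge_point subr0 mul1r mul0r addr0. Qed.

Lemma edge_point1E u w : edge_point u w 1 = vertex_point w.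
Proof. by apply/funext => v; rewrite /edge_point subrr mul1r mul0r add0r. Qed.

Section Cycles.
Implicit Types s : seq G.

Lemma next_inj_edges s : uniq s -> (2 < size s)%N ->
  {in s &, injective (fun x => [set x; next s x]%SET)}.
Proof.
move=> us s3 x y xs ys /setP exy; apply/eqP; apply: contraT => xy.
have /eqP yx : next s x == y.
  by have := exy y; rewrite !inE eqxx orTb (eq_sym y) (negbTE xy) /= eq_sym.
have /eqP : x == next s y.
  by have := exy x; rewrite !inE eqxx (negbTE xy) /= => <-.
rewrite -yx; have [i s' rs] := rot_to xs.
have us' : uniq (x :: s') by rewrite -rs rot_uniq.
have : (2 < size (x :: s'))%N by rewrite -rs size_rot.
rewrite -!(next_rot i us) rs; case: s' us' {rs} => [|z [|w s']] //=.
rewrite !inE !negb_or -!andbA => /and5P[xz xw _ zw _] _.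
by rewrite !eqxx eq_sym (negbTE xz) => xw'; rewrite xw' eqxx in xw.
Qed.

Lemma card_cycle_edges s : uniq s -> (2 < size s)%N -> #|cycle_edges s| = size s.
Proof.
move=> us s3; rewrite /cycle_edges card_in_imset; first exact/card_uniqP.
exact: next_inj_edges.
Qed.

Lemma cover_cycle_edges s : finset.cover (cycle_edges s) =i s.
Proof.
move=> x; apply/bigcupP/idP => [[e /imsetP[y ys ->]]|xs].
  by rewrite !inE => /orP[]/eqP-> //; rewrite mem_next.
by exists [set x; next s x]%SET; [apply: imset_f|rewrite !inE eqxx].
Qed.

Lemma cycle_edges_sub s : ucycle (@adj G) s -> cycle_edges s \subset edges G.
Proof.
move=> /andP[cs us]; apply/fintype.subsetP => _ /imsetP[x xs ->].
apply/imsetP; exists (x, next s x) => //; rewrite inE /=.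
exact: next_cycle.
Qed.

End Cycles.

Lemma edges_sub_simplices : edges G \subset simplices G.
Proof. exact: finset.subsetUl. Qed.

Section Embedding.
Variable f : {ptws G -> R} -> point.
Hypothesis emb : graph_embedding f.

Lemma image_disjoint C C' : C \subset edges G -> C' \subset edges G ->
  vertex_disjoint C C' ->
  (f @` realization R C) `&` (f @` realization R C') = set0.
Proof.
move=> CE CE' dis; rewrite -subset0 => _ [[p Cp <-] [q Cq fpq]].
have sub (D : {set {set G}}) : D \subset edges G -> realization R D `<=` graph_space R G.
  move=> DE; exact: (realizationS (fintype.subset_trans DE edges_sub_simplices)).
have pq : q = p by apply: emb.2 fpq; rewrite inE; [exact: (sub C')|exact: (sub C)].
suff : (set0 : set {ptws G -> R}) p by [].
by rewrite -(realization_disjoint dis); split=> //; rewrite -pq.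
Qed.

Lemma embedding_within C : C \subset edges G -> {within realization R C, continuous f}.
Proof.
move=> CE; apply: continuous_subspaceW emb.1.
exact: (realizationS (fintype.subset_trans CE edges_sub_simplices)).
Qed.

Lemma image_compact C : C \subset edges G -> compact (f @` realization R C).
Proof.
by move=> CE; apply: continuous_compact (embedding_within CE) (realization_compact CE).
Qed.

Lemma edge_in_edges u w : adj u w -> [set [set u; w]]%SET \subset edges G.
Proof.
by move=> uw; rewrite finset.sub1set; apply/imsetP; exists (u, w); rewrite ?inE.
Qed.

(** A polygon inscribed in the image of an edge: the image is connected, and
    its two end points are distinct because f is injective. *)
Lemma edge_chain u w d : adj u w -> 0 < d ->
  exists A : seq (point * point), [/\
    bounds A (f (vertex_point u)) (f (vertex_point w)),
    f (vertex_point u) \in ends A /\ f (vertex_point w) \in ends A,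
    forall x, x \in ends A -> (f @` realization R [set [set u; w]]%SET) x &
    forall s, s \in A -> `|s.1 - s.2| < d].
Proof.
move=> auw d0; have uw : u != w by apply: contraTneq auw => ->; rewrite adj_irrefl.
pose K := f @` realization R [set [set u; w]]%SET.
have cK : connected K.
  apply: connected_continuous_connected (edge_connected uw) _.
  exact/embedding_within/edge_in_edges.
have Ku : K (f (vertex_point u)).
  by exists (vertex_point u) => //; rewrite -(edge_point0E u w); apply: edge_point0.
have Kw : K (f (vertex_point w)).
  by exists (vertex_point w) => //; rewrite -(edge_point1E u w); apply: edge_point1.
have [s [lst sK mesh]] := connected_chain cK Ku Kw d0.
have [s0|s0] := eqVneq s [::].
  have sub := realizationS (fintype.subset_trans (edge_in_edges auw) edges_sub_simplices).
  have puw : vertex_point u = vertex_point w.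
    apply: emb.2; last by rewrite -lst s0.
      by rewrite inE; apply: sub; rewrite -(edge_point0E u w); apply: edge_point0.
    by rewrite inE; apply: sub; rewrite -(edge_point1E u w); apply: edge_point1.
  move: (congr1 (fun p : {ptws G -> R} => p u) puw).
  by rewrite /vertex_point eqxx (negbTE uw) => /eqP; rewrite oner_eq0.
exists (segs (f (vertex_point u)) s); split=> //.
- by rewrite -lst; apply: segs_bounds.
- by rewrite -lst; apply: segs_ends.
- by move=> x /ends_segs/sK.
Qed.

End Embedding.
End Graph.

(** * Every embedding has a linked triangle and quadrilateral *)

Definition K331_vertex (k : 'I_3) (i : 'I_(nth 0 [:: 3; 3; 1] k)%N) : K331 :=
  existT (fun k : 'I_3 => 'I_(nth 0 [:: 3; 3; 1] k)%N) k i.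

Definition vA (i : 'I_3) : K331 := @K331_vertex 0 i.
Definition vB (i : 'I_3) : K331 := @K331_vertex 1 i.
Definition vC : K331 := @K331_vertex 2 ord0.

Lemma vA_inj : injective vA.
Proof. by move=> i j /eqP; rewrite -tag_eqE /tag_eq /= tagged_asE => /eqP. Qed.

Lemma vB_inj : injective vB.
Proof. by move=> i j /eqP; rewrite -tag_eqE /tag_eq /= tagged_asE => /eqP. Qed.

Lemma vAE i j : (vA i == vA j) = (i == j).
Proof. exact: inj_eq vA_inj _ _. Qed.

Lemma vBE i j : (vB i == vB j) = (i == j).
Proof. exact: inj_eq vB_inj _ _. Qed.

Lemma adjAB i j : adj (vA i) (vB j). Proof. by []. Qed.
Lemma adjCA i : adj vC (vA i). Proof. by []. Qed.
Lemma adjCB i : adj vC (vB i). Proof. by []. Qed.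
Lemma I3_others (a : 'I_3) : [/\ a + 1 != a, a + 2 != a & a + 1 != a + 2].
Proof. by case: a => -[|[|[|]]]. Qed.

Lemma I3_othersP (a i : 'I_3) : i != a -> i = a + 1 \/ i = a + 2.
Proof.
case: a => -[|[|[|//]]] pa; case: i => -[|[|[|//]]] pi ne;
  solve [left; by apply: val_inj | right; by apply: val_inj | by case/eqP: ne; apply: val_inj].
Qed.

Definition triangle a b := [:: vC; vA a; vB b].
Definition quad a b : seq K331 := [:: vA (a + 1); vB (b + 1); vA (a + 2); vB (b + 2)].
Definition cycle3 a b := cycle_edges (triangle a b).
Definition cycle4 a b := cycle_edges (quad a b).

Lemma vAB i j : (vA i == vB j) = false. Proof. by []. Qed.
Lemma vBA i j : (vB i == vA j) = false. Proof. by []. Qed.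

Lemma triangle_cycle a b : ucycle (@adj K331) (triangle a b).
Proof. by []. Qed.

Lemma quad_cycle a b : ucycle (@adj K331) (quad a b).
Proof.
have [[_ _ a12] [_ _ b12]] := (I3_others a, I3_others b).
by rewrite /ucycle /= !inE !vAB !vBA !vAE !vBE (negbTE a12) (negbTE b12).
Qed.

Lemma T_cycle a b : is_cycle (cycle3 a b).
Proof. by exists (triangle a b); split=> //; apply: triangle_cycle. Qed.

Lemma Q_cycle a b : is_cycle (cycle4 a b).
Proof. by exists (quad a b); split=> //; apply: quad_cycle. Qed.

Lemma card_T a b : #|cycle3 a b| = 3%N.
Proof. by rewrite card_cycle_edges //; case/andP: (triangle_cycle a b). Qed.

Lemma card_Q a b : #|cycle4 a b| = 4%N.
Proof. by rewrite card_cycle_edges //; case/andP: (quad_cycle a b). Qed.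

Lemma TQ_disjoint a b : vertex_disjoint (cycle3 a b) (cycle4 a b).
Proof.
have [[a1 a2 _] [b1 b2 _]] := (I3_others a, I3_others b).
rewrite /vertex_disjoint (eq_disjoint (cover_cycle_edges _)).
rewrite disjoint_sym (eq_disjoint (cover_cycle_edges _)) disjoint_has /=.
by rewrite !inE !vAB !vBA !vAE !vBE (negbTE a1) (negbTE a2) (negbTE b1) (negbTE b2).
Qed.

Lemma edgeT a b : [/\ [set vC; vA a]%SET \in cycle3 a b, [set vA a; vB b]%SET \in cycle3 a b
   & [set vC; vB b]%SET \in cycle3 a b].
Proof.
split; apply/imsetP.
- by exists vC; rewrite ?inE //= eqxx.
- by exists (vA a); rewrite ?inE ?eqxx ?orbT //= eqxx.
- exists (vB b); rewrite ?inE ?eqxx ?orbT //= eqxx.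
  by rewrite finset.setUC.
Qed.

Lemma next4 (V : eqType) (p q r t : V) : uniq [:: p; q; r; t] ->
  [/\ next [:: p; q; r; t] p = q, next [:: p; q; r; t] q = r,
      next [:: p; q; r; t] r = t & next [:: p; q; r; t] t = p].
Proof.
rewrite /= !inE !negb_or -!andbA ![p == _]eq_sym ![q == r]eq_sym ![q == t]eq_sym.
rewrite ![r == t]eq_sym => /and5P[/negbTE qp /negbTE rp /negbTE tp /negbTE rq].
by move=> /and3P[/negbTE tq /negbTE tr _]; rewrite !eqxx qp rp tp rq tq tr.
Qed.

(** The other two vertices of each part are a + 1 and a + 2 modulo 3. *)
Lemma edgeQ a b i j : i != a -> j != b -> [set vA i; vB j]%SET \in cycle4 a b.
Proof.
have [n1 n2 n3 n4] := next4 (andP (quad_cycle a b)).2.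
move=> /I3_othersP ia /I3_othersP jb; apply/imsetP.
case: ia => ->; case: jb => ->.
- by exists (vA (a + 1)); rewrite ?n1 // !inE eqxx.
- by exists (vB (b + 2)); rewrite ?n4 1?finset.setUC // !inE eqxx !orbT.
- by exists (vB (b + 1)); rewrite ?n2 1?finset.setUC // !inE eqxx !orbT.
- by exists (vA (a + 2)); rewrite ?n3 // !inE eqxx !orbT.
Qed.

Section Linked. Variable R : realType.
Local Notation point := 'rV[R]_3.

Lemma curve_points_generic : exists L : seq point, [/\ generic L, has_curve L &
  forall x, x \in L -> exists2 n, (n < 8)%N & x = curve R n].
Proof.
exists [seq curve R n | n <- iota 0 8]; split.
- move=> x y z w sub.
  have get u : u \in [:: x; y; z; w] -> exists n, u = curve R n.
    by move=> /sub/mapP[n _ ->]; exists n.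
  have [i ->] := get x (mem_head _ _).
  have [|j ->] := get y; first by rewrite !inE eqxx orbT.
  have [|k ->] := get z; first by rewrite !inE eqxx !orbT.
  have [|l ->] := get w; first by rewrite !inE eqxx !orbT.
  rewrite /= !inE !negb_or !(inj_eq (@curve_inj R)) andbT vol_curve.
  move=> /and3P[/and3P[ij ik il] /andP[jk jl] kl].
  by rewrite !mulf_neq0 // subr_eq0 eqr_nat eq_sym.
- by move=> n n8; apply: map_f; rewrite mem_iota.
- by move=> x /mapP[n]; rewrite mem_iota => /andP[_ n8] ->; exists n.
Qed.

(** If all nine pairs were split, polygons inscribed finely enough in the
    images of the edges would all have linking number zero, and their sum would
    not be 1. *)
Lemma K331_linked (f : {ptws K331 -> R} -> point) : graph_embedding f ->
  exists a b, is_link f (cycle3 a b) (cycle4 a b).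
Proof.
move=> emb; apply: contrapT => none.
have Tsub a b : cycle3 a b \subset edges K331 := cycle_edges_sub (triangle_cycle a b).
have Qsub a b : cycle4 a b \subset edges K331 := cycle_edges_sub (quad_cycle a b).
pose KT a b := f @` realization R (cycle3 a b); pose KQ a b := f @` realization R (cycle4 a b).
pose arc u w := f @` realization R [set [set u; w]]%SET.
have arcT a b : [/\ arc vC (vA a) `<=` KT a b, arc (vA a) (vB b) `<=` KT a b &
    arc vC (vB b) `<=` KT a b].
  have [e1 e2 e3] := edgeT a b.
  by split; apply/image_subset/realizationS; rewrite finset.sub1set.
have arcQ a b i j : i != a -> j != b -> arc (vA i) (vB j) `<=` KQ a b.
  by move=> ia jb; apply/image_subset/realizationS; rewrite finset.sub1set edgeQ.
have split_ab a b : split_link (KT a b) (KQ a b).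
  apply: contrapT => ns; apply: none; exists a, b; split=> //.
  - exact: T_cycle.
  - exact: Q_cycle.
  - exact: TQ_disjoint.
have /choice[d dP] : forall ab : 'I_3 * 'I_3, exists d : R, 0 < d /\
    forall L pi A B, generic L -> has_curve L ->
    fine_loop (KT ab.1 ab.2) d A -> fine_loop (KQ ab.1 ab.2) d B ->
    {in ends A ++ ends B, forall x, `|pi x - x| < d} ->
    placed L (curve R 0) (push pi A) (push pi B) ->
    placed L (curve R 7) (push pi A) (push pi B) ->
    crossing (curve R 0) (push pi A) (push pi B) = false.
  move=> [a b]; have [||||d d0 H] := split_unlinked _ _ _ _ (split_ab a b).
  - exact: image_compact.
  - exact: image_compact.
  - have [h _ _] := arcT a b; exists (f (vertex_point R vC)); apply: h.
    exists (vertex_point R vC) => //; rewrite -(edge_point0E R vC (vA a)).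
    exact: edge_point0.
  - have [a1 _ _] := I3_others a; have [b1 _ _] := I3_others b.
    have h := arcQ a b _ _ a1 b1; exists (f (vertex_point R (vA (a + 1)))); apply: h.
    exists (vertex_point R (vA (a + 1))) => //.
    rewrite -(edge_point0E R _ (vB (b + 1))); exact: edge_point0.
  by exists d.
pose d1 := \big[Num.min/1]_ab d ab.
have d1_gt0 : 0 < d1 by apply: lt_bigmin => // ab _; case: (dP ab).
have d1_le ab : d1 <= d ab by apply: bigmin_le_cond.
have chain u w (uw : adj u w) := edge_chain emb uw d1_gt0.
have /choice[F FP] a := chain _ _ (adjCA a).
have /choice[F' F'P] b := chain _ _ (adjCB b).
have /choice[E EP] ab := chain _ _ (adjAB ab.1 ab.2).
pose E' a b := E (a, b).
pose X := flatten [seq ends (F a) | a : 'I_3] ++ (flatten [seq ends (F' b) | b : 'I_3] ++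
  flatten [seq ends (E ab) | ab : 'I_3 * 'I_3]).
have FX a x : x \in ends (F a) -> x \in X.
  move=> xF; rewrite mem_cat; apply/orP; left.
  by apply/flatten_mapP; exists a; rewrite ?mem_enum.
have F'X b x : x \in ends (F' b) -> x \in X.
  move=> xF; rewrite !mem_cat; apply/or3P; apply: Or32.
  by apply/flatten_mapP; exists b; rewrite ?mem_enum.
have EX a b x : x \in ends (E' a b) -> x \in X.
  move=> xE; rewrite !mem_cat; apply/or3P; apply: Or33.
  by apply/flatten_mapP; exists (a, b); rewrite ?mem_enum.
have [L0 [gL0 cL0 L0P]] := curve_points_generic.
have [pi [pi_inj near avoid gL]] := perturb X gL0 cL0 d1_gt0.
pose L := map pi X ++ L0.
have cL : has_curve L by move=> n n8; rewrite mem_cat cL0 ?orbT.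
have XL x : x \in X -> pi x \in L by move=> xX; rewrite mem_cat map_f.
have Xcurve n x : (n < 8)%N -> x \in X -> curve R n != pi x.
  by move=> n8 /avoid; apply: contraNneq => <-; apply: cL0.
have E_disj a b i j : i != a -> j != b -> forall x, x \in ends (E' a b) ->
    x \notin ends (E' i j).
  move=> ia jb x xE; apply/negP => xE'.
  have [_ _ /(_ x xE) xK _] := EP (a, b); have [_ _ /(_ x xE') xK' _] := EP (i, j).
  have [_ hT _] := arcT a b; suff : (set0 : set point) x by [].
  rewrite -(image_disjoint emb (Tsub a b) (Qsub a b) (TQ_disjoint a b)).
  by split; [apply: hT|apply: (arcQ a b i j ia jb)].
have [] : exists a b, crossing (curve R 0)
    (push pi (F a) ++ push pi (E' a b) ++ push pi (F' b))
    (avoiding (fun i j => push pi (E' i j)) a b).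
  apply: contrapT => nc.
  have := @odd_total_crossing R L (fun a => pi (f (vertex_point R (vA a))))
    (fun b => pi (f (vertex_point R (vB b)))) (fun i j => push pi (E' i j)) gL cL
    _ _ _ _ _ _ (fun a => push pi (F a)) (fun b => push pi (F' b)).
  rewrite big1 => [H|a _].
    suff : false by []; apply: H.
    - by move=> a b x; rewrite ends_push => /mapP[y /EX yX ->]; apply: XL.
    - move=> a b n n8; rewrite ends_push; apply/negP => /mapP[y /EX yX].
      by move/eqP; rewrite (negbTE (Xcurve _ _ n8 yX)).
    - by move=> a b; apply: push_bounds; have [] := EP (a, b).
    - by move=> a b; rewrite ends_push map_f //; have [_ []] := EP (a, b).
    - by move=> a b; rewrite ends_push map_f //; have [_ []] := EP (a, b).
    - move=> a b i j ia jb x; rewrite !ends_push => /mapP[y yE ->].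
      apply/negP => /mapP[z zE] /(pi_inj _ _ (EX _ _ _ yE) (EX _ _ _ zE)) yz.
      by move: (E_disj a b i j ia jb y yE); rewrite yz zE.
  rewrite big1 // => b _; apply/negbTE/negP => c; apply: nc; by exists a, b.
move=> a [b]; pose A := F a ++ E' a b ++ F' b; pose B := avoiding E' a b.
have -> : push pi (F a) ++ push pi (E' a b) ++ push pi (F' b) = push pi A.
  by rewrite !push_cat.
have -> : avoiding (fun i j => push pi (E' i j)) a b = push pi B.
  rewrite /B /avoiding (big_morph _ (push_cat pi) (erefl : push pi [::] = [::])).
  by apply: eq_bigr => i _; rewrite (big_morph _ (push_cat pi) (erefl : push pi [::] = [::])).
have endsA x : x \in ends A -> KT a b x /\ x \in X.
  rewrite /A !mem_ends_cat => /or3P[] xin.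
  - by split; [case: (arcT a b) => h _ _; apply: h; case: (FP a) => _ _ h' _; apply: h'|apply: FX xin].
  - by split; [case: (arcT a b) => _ h _; apply: h; case: (EP (a, b)) => _ _ h' _; apply: h'|apply: EX xin].
  - by split; [case: (arcT a b) => _ _ h; apply: h; case: (F'P b) => _ _ h' _; apply: h'|apply: F'X xin].
have endsB x : x \in ends B -> KQ a b x /\ x \in X.
  rewrite ends_avoiding => /existsP[i /existsP[j /and3P[ia jb xin]]].
  by split; [apply: (arcQ a b i j ia jb); case: (EP (i, j)) => _ _ h' _; apply: h'|apply: EX xin].
have AB x : x \in ends A -> x \notin ends B.
  move=> /endsA[xT _]; apply/negP => /endsB[xQ _]; suff : (set0 : set point) x by [].
  by rewrite -(image_disjoint emb (Tsub a b) (Qsub a b) (TQ_disjoint a b)).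
have memB s : s \in B -> exists i j, s \in E' i j.
  rewrite /B /avoiding; elim/big_rec: _ => // i B' _ IH; rewrite mem_cat => /orP[|/IH//].
  elim/big_rec: _ => // j B'' _ IH'; rewrite mem_cat => /orP[sE|/IH'//].
  by exists i, j.
have pl n : (n < 8)%N -> placed L (curve R n) (push pi A) (push pi B).
  move=> n8; split=> //.
  - move=> x; rewrite inE mem_cat !ends_push => /or3P[/eqP->|/mapP[y /endsA[_ yX] ->]|/mapP[y /endsB[_ yX] ->]];
      by [apply: cL|apply: XL].
  - rewrite ends_push; apply/negP => /mapP[y /endsA[_ yX] /eqP].
    by rewrite (negbTE (Xcurve _ _ n8 yX)).
  - rewrite ends_push; apply/negP => /mapP[y /endsB[_ yX] /eqP].
    by rewrite (negbTE (Xcurve _ _ n8 yX)).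
  - move=> x; rewrite !ends_push => /mapP[y yA ->]; have [_ yX] := endsA _ yA.
    apply/negP => /mapP[z zB]; have [_ zX] := endsB _ zB.
    by move=> /(pi_inj _ _ yX zX) yz; move: (AB _ yA); rewrite yz zB.
have bnd : forall i j, bounds (E' i j) (f (vertex_point R (vA i))) (f (vertex_point R (vB j))).
  by move=> i j; have [] := EP (i, j).
have [_ H] := dP (a, b).
rewrite (H L pi A B gL cL) //.
- split.
  + rewrite /A catA; have [bF _ _ _] := FP a; have [bF' _ _ _] := F'P b.
    exact: bounds_closed (bounds_cat bF (bnd a b)) bF'.
  + by move=> x /endsA[].
  + move=> s; rewrite !mem_cat => sA; apply: lt_le_trans (d1_le (a, b)).
    by case/or3P: sA; [case: (FP a)|case: (EP (a, b))|case: (F'P b)] => _ _ _; apply.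
- split.
  + exact: avoiding_closed bnd.
  + by move=> x /endsB[].
  + move=> s /memB[i [j sE]]; apply: lt_le_trans (d1_le (a, b)).
    by case: (EP (i, j)) => _ _ _; apply.
- move=> x xin; apply: lt_le_trans (d1_le (a, b)); apply: near.
  by move: xin; rewrite mem_cat => /orP[/endsA[]|/endsB[]].
- exact: pl.
- exact: pl.
Qed.
End Linked.

(** * Ellipsoids that separate *)

Section Ellipsoid. Variable R : realType.
Local Notation point := 'rV[R]_3.
Implicit Types (x y z k : point) (A B S : set point).

Definition affine_map k0 k1 k2 k x : point :=
  x 0 0 *: k0 + x 0 1 *: k1 + x 0 2 *: k2 + k.

Lemma affine_map_continuous k0 k1 k2 k : continuous (affine_map k0 k1 k2 k).
Proof.
move=> x; have cc i (v : point) : (fun y : point => y 0 i *: v) @ x --> x 0 i *: v.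
  exact: (cvgZ (@coord_continuous R 1 3 0 i x) (cvg_cst v)).
exact: (cvgD (cvgD (cvgD (cc 0 k0) (cc 1 k1)) (cc 2 k2)) (cvg_cst k)).
Qed.

(** The inverse is given by the rule of Cramer. *)
Lemma affine_homeomorphism k0 k1 k2 k : det3 k0 k1 k2 != 0 ->
  exists h : point -> point, [/\ continuous h, cancel h (affine_map k0 k1 k2 k) &
    cancel (affine_map k0 k1 k2 k) h].
Proof.
move=> d0; pose d := det3 k0 k1 k2.
pose lin x : point := \row_i [:: det3 x k1 k2; det3 k0 x k2; det3 k0 k1 x]`_i.
pose h x := d^-1 *: lin (x - k).
exists h; split.
- have -> : h = affine_map (d^-1 *: lin (delta_mx 0 0)) (d^-1 *: lin (delta_mx 0 1))
      (d^-1 *: lin (delta_mx 0 2)) (d^-1 *: lin (- k)).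
    apply/funext => x; apply/rowP; apply: ord3P;
      rewrite /h /affine_map !mxE /= /det3 !mxE /=; ring.
  exact: affine_map_continuous.
- move=> x; apply/rowP; rewrite /h /affine_map /d; apply: ord3P;
    move: d0; rewrite !mxE /= /det3 !mxE /= => d0; field.
  exact: d0. exact: d0. exact: d0.
- move=> x; apply/rowP; rewrite /h /affine_map /d; apply: ord3P;
    move: d0; rewrite !mxE /= /det3 !mxE /= => d0; field.
  exact: d0. exact: d0. exact: d0.
Qed.

Lemma split_linkC A B : split_link A B -> split_link B A.
Proof.
move=> [S [tS dis sep]]; exists S; split=> //; first by rewrite setUC.
move=> x y Bx Ay xy; apply: (sep y x Ay Bx).
exact: connected_component_sym.
Qed.

(** The ellipsoid where the affine map takes values of norm s is the image of
    the unit sphere by the inverse map.  A connected set that contains points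
    on both sides of it meets it, by the intermediate value theorem. *)
Lemma ellipsoid_split k0 k1 k2 k (s : R) A B : det3 k0 k1 k2 != 0 -> 0 < s ->
  (forall x, A x -> sqnorm (affine_map k0 k1 k2 k x) < s ^+ 2) ->
  (forall x, B x -> s ^+ 2 < sqnorm (affine_map k0 k1 k2 k x)) ->
  split_link A B.
Proof.
move=> d0 s0 inA outB; pose g := affine_map k0 k1 k2 k.
have [h [ch hK gK]] := affine_homeomorphism k d0.
have sv0 : s != 0 by rewrite gt_eqF.
pose h' x := h (s *: x); pose g' x := s^-1 *: g x.
have cscale (a : R) : continuous (fun x : point => a *: x).
  exact: scaler_continuous.
have cg' : continuous g'.
  move=> x; apply: (continuous_comp (f := g) (g := fun y => s^-1 *: y)).
    exact: affine_map_continuous.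
  exact: cscale.
have sq_g' x : sqnorm (g' x) = s ^- 2 * sqnorm (g x) by rewrite sqnormZ exprVn.
have s2 : 0 < s ^+ 2 by rewrite exprn_gt0.
exists (h' @` @unit_sphere R); split.
- exists h' => //; split.
    move=> x; apply: (continuous_comp (f := fun y => s *: y) (g := h)).
      exact: cscale.
    exact: ch.
  exists g'; split=> // x; rewrite /h' /g'.
    by rewrite /g hK scalerA mulVf // scale1r.
  by rewrite scalerA mulfV // scale1r gK.
- rewrite -subset0 => _ [[u u1 <-] ABu].
  have gh : sqnorm (g (h' u)) = s ^+ 2.
    by rewrite /g hK sqnormZ /sqnorm u1 mulr1.
  by case: ABu => [/inA|/outB]; rewrite -/(g _) gh ltxx.
- move=> x y Ax By [C [Cx CS cC] Cy].
  pose phi z := sqnorm (g z).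
  have cphi : continuous phi.
    move=> z; apply: (continuous_comp (f := g) (g := @sqnorm R)).
      exact: affine_map_continuous.
    exact: sqnorm_continuous.
  have /(connected_intervalP (phi @` C)).1 iv : connected (phi @` C).
    by apply: connected_continuous_connected => //; apply: continuous_subspaceT.
  have [z Cz zs] : (phi @` C) (s ^+ 2).
    apply: (iv (phi x) (phi y)); [by exists x|by exists y|].
    by apply/andP; split; apply/ltW; [apply: inA|apply: outB].
  apply: (CS z Cz); exists (g' z); last by rewrite /h' /g' scalerA mulfV // scale1r gK.
  by rewrite /unit_sphere /= -/(sqnorm _) sq_g' -/(phi z) zs mulVf // gt_eqF.
Qed.

Lemma sqnorm_segment x y (t : R) : sqnorm ((1 - t) *: x + t *: y) =
  (1 - t) ^+ 2 * sqnorm x + 2 * t * (1 - t) * (\sum_i x 0 i * y 0 i) + t ^+ 2 * sqnorm y.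
Proof.
have -> : \sum_i x 0 i * y 0 i = x 0 0 * y 0 0 + x 0 1 * y 0 1 + x 0 2 * y 0 2.
  rewrite !big_ord_recl big_ord0 addr0 addrA.
  by congr (_ + _ + _); congr (x 0 _ * y 0 _); apply: val_inj.
by rewrite !sqnorm3 !mxE; ring.
Qed.

Lemma segment_inside x y (s2 t : R) : 0 <= t <= 1 -> sqnorm x < s2 -> sqnorm y < s2 ->
  sqnorm ((1 - t) *: x + t *: y) < s2.
Proof.
move=> /andP[t0 t1] xs ys; rewrite sqnorm_segment.
have : \sum_i x 0 i * y 0 i <= (sqnorm x + sqnorm y) / 2.
  rewrite /sqnorm -big_split /= mulr_suml ler_sum // => i _.
  by have := sqr_ge0 (x 0 i - y 0 i); rewrite sqrrB; lra.
move: (\sum_i _) (sqnorm x) (sqnorm y) xs ys => b a c ac cc bc.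
have b2 : 0 <= 2 * t * (1 - t) by rewrite mulr_ge0 ?mulr_ge0 ?subr_ge0.
have := ler_wpM2l b2 bc.
have [tz|tnz] := eqVneq t 0; first by rewrite tz; lra.
have tp : 0 < t by rewrite lt_neqAle eq_sym tnz.
have h1 : t * c < t * s2 by rewrite ltr_pM2l.
have h2 : (1 - t) * a <= (1 - t) * s2 by rewrite ler_wpM2l ?subr_ge0 // ltW.
nra.
Qed.

(** With a and c the values at the ends of sqnorm - s2, the restriction of
    this function to the segment is the quadratic form (a, b, c) in (1 - t, t).
    It is positive on the positive quadrant if b is nonnegative or the
    discriminant is negative. *)
Lemma segment_outside x y (s2 t : R) : 0 <= t <= 1 ->
  let b := \sum_i x 0 i * y 0 i - s2 in
  s2 < sqnorm x -> s2 < sqnorm y ->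
  (0 <= b) || (b ^+ 2 < (sqnorm x - s2) * (sqnorm y - s2)) ->
  s2 < sqnorm ((1 - t) *: x + t *: y).
Proof.
move=> /andP[t0 t1] b xs ys hb; rewrite sqnorm_segment -subr_gt0.
have -> : (1 - t) ^+ 2 * sqnorm x + 2 * t * (1 - t) * (\sum_i x 0 i * y 0 i) +
    t ^+ 2 * sqnorm y - s2 =
  (1 - t) ^+ 2 * (sqnorm x - s2) + 2 * t * (1 - t) * b + t ^+ 2 * (sqnorm y - s2).
  by rewrite /b; ring.
move: xs ys hb; rewrite -(subr_gt0 s2) -(subr_gt0 s2 (sqnorm y)).
move: (sqnorm x - s2) (sqnorm y - s2) b => a c b' a0 c0 /orP[b0|bac].
  have [tz|tnz] := eqVneq t 0; first by rewrite tz; lra.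
  have tp : 0 < t ^+ 2 by rewrite exprn_gt0 // lt_neqAle eq_sym tnz.
  have := mulr_gt0 tp c0.
  have := mulr_ge0 (sqr_ge0 (1 - t)) (ltW a0).
  have : 0 <= 2 * t * (1 - t) * b' by rewrite !mulr_ge0 ?subr_ge0.
  by lra.
(* completing the square *)
rewrite -(pmulr_rgt0 _ a0).
have -> : a * ((1 - t) ^+ 2 * a + 2 * t * (1 - t) * b' + t ^+ 2 * c) =
  ((1 - t) * a + t * b') ^+ 2 + t ^+ 2 * (a * c - b' ^+ 2) by ring.
have [tz|tnz] := eqVneq t 0.
  by rewrite tz subr0 mul1r mul0r addr0 expr0n /= mul0r addr0 exprn_gt0.
by rewrite ltr_wpDl ?sqr_ge0 // mulr_gt0 ?subr_gt0 // exprn_gt0 // lt_neqAle eq_sym tnz.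
Qed.
End Ellipsoid.

(** * Straight-line embeddings *)

Section StraightLine. Variables (R : realType) (G : sgraph).
Local Notation point := 'rV[R]_3.
Variable X : G -> point.
Implicit Types (u w : G).

Definition straight (p : {ptws G -> R}) : point := \sum_v p v *: X v.

Lemma straight_continuous : continuous straight.
Proof.
pose S s (q : {ptws G -> R}) : point := \sum_(v <- s) q v *: X v.
suff cS s : continuous (S s) by exact: (cS (index_enum G)).
elim: s => [|v s IH].
  have -> : S [::] = fun=> 0 by apply/funext => q; rewrite /S big_nil.
  exact: (@cst_continuous {ptws G -> R} point 0).
have -> : S (v :: s) = fun q => q v *: X v + S s q.
  by apply/funext => q; rewrite /S big_cons.
move=> p.
have FF : Filter (nbhs p) := nbhs_filter p.
have pv := @proj_continuous G (fun=> R) v p.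
have h := cvgZr_tmp (a := X v) pv.
exact: (cvgD (h FF) (IH p)).
Qed.

Lemma straight_edge u w t : straight (edge_point u w t) = (1 - t) *: X u + t *: X w.
Proof.
rewrite /straight /edge_point; under eq_bigr do rewrite scalerDl.
rewrite big_split /= (bigD1 u) //= eqxx mulr1 big1 ?addr0; last first.
  by move=> v /negbTE ->; rewrite mulr0 scale0r.
rewrite (bigD1 w) //= eqxx mulr1 big1 ?addr0 //.
by move=> v /negbTE ->; rewrite mulr0 scale0r.
Qed.

Lemma straight_polygonal e : e \in edges G ->
  polygonal (straight @` realization R [set e]%SET).
Proof.
move=> /imsetP[[u w]]; rewrite inE /= => uw ->.
have uw' : u != w by apply: contraTneq uw => ->; rewrite adj_irrefl.
exists [:: (X u, X w)]; rewrite realization_edge //.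
apply/seteqP; split=> [_ [_ [t t01 <-] <-]|x [ab /= abin [t t01 <-]]].
  exists (X u, X w); first by rewrite /= inE.
  by rewrite straight_edge; exists t.
move: abin; rewrite inE => /eqP->; exists (edge_point u w t); first by exists t.
by rewrite straight_edge.
Qed.

(** Each coefficient times the volume is a determinant in which a column is
    replaced by the combination of the columns, which is zero. *)
Lemma affine_independent (x y z w : point) (a b c d : R) : vol x y z w != 0 ->
  a + b + c + d = 0 -> a *: x + b *: y + c *: z + d *: w = 0 ->
  [/\ a = 0, b = 0, c = 0 & d = 0].
Proof.
move=> v0 s0 /rowP comb.
have aE : a = - b - c - d by apply/eqP; rewrite -subr_eq0; apply/eqP; rewrite -s0; ring.
have := (comb 0, comb 1, comb 2); rewrite !mxE aE => -[[c0 c1] c2].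
have key i : b * (y - x) 0 i + c * (z - x) 0 i + d * (w - x) 0 i =
    (- b - c - d) * x 0 i + b * y 0 i + c * z 0 i + d * w 0 i.
  by rewrite !mxE; ring.
have k0 := key 0; have k1 := key 1; have k2 := key 2; rewrite ?c0 ?c1 ?c2 in k0 k1 k2.
have kill r e : r * vol x y z w = e -> e = 0 -> r = 0.
  by move=> re e0; move: re; rewrite e0 => /eqP; rewrite mulf_eq0 (negbTE v0) orbF => /eqP.
have b0 : b = 0.
  apply: (kill b (det3 (b *: (y - x) + c *: (z - x) + d *: (w - x)) (z - x) (w - x))).
    by rewrite /vol /det3 !mxE; ring.
  by move: k0 k1 k2; rewrite /det3 !mxE => -> -> ->; ring.
have c_0 : c = 0.
  apply: (kill c (det3 (y - x) (b *: (y - x) + c *: (z - x) + d *: (w - x)) (w - x))).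
    by rewrite /vol /det3 !mxE; ring.
  by move: k0 k1 k2; rewrite /det3 !mxE => -> -> ->; ring.
have d0 : d = 0.
  apply: (kill d (det3 (y - x) (z - x) (b *: (y - x) + c *: (z - x) + d *: (w - x)))).
    by rewrite /vol /det3 !mxE; ring.
  by move: k0 k1 k2; rewrite /det3 !mxE => -> -> ->; ring.
by split=> //; rewrite b0 c_0 d0 !subr0 oppr0.
Qed.

Hypothesis genX : forall u v w z, uniq [:: u; v; w; z] -> vol (X u) (X v) (X w) (X z) != 0.
Hypothesis G4 : (4 <= #|G|)%N.

Lemma four_points (s : seq G) : (size s <= 4)%N -> exists u v w z,
  uniq [:: u; v; w; z] /\ {subset s <= [:: u; v; w; z]}.
Proof.
move=> s4; pose r := undup s ++ [seq x <- enum G | x \notin s].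
have ur : uniq r.
  rewrite cat_uniq undup_uniq filter_uniq ?enum_uniq // andbT.
  by apply/hasPn => x; rewrite mem_filter mem_undup => /andP[].
have r_all x : x \in r.
  by rewrite mem_cat mem_undup mem_filter mem_enum andbT; case: (x \in s).
have size_r : (4 <= size r)%N.
  apply: leq_trans G4 _; rewrite cardE; apply: uniq_leq_size (enum_uniq _) _ => x _.
  exact: r_all.
have sub : {subset s <= take 4 r}.
  move=> x xs; rewrite take_cat; case: ltnP => h; last by rewrite mem_cat mem_undup xs.
  by have := leq_ltn_trans (size_undup s) (leq_ltn_trans s4 h); rewrite ltnn.
have := take_uniq 4 ur; have : size (take 4 r) = 4 by rewrite size_takel.
case: (take 4 r) sub => [|u [|v [|w [|z [|]]]]] // sub _ un.
by exists u, v, w, z.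
Qed.

(** Two points of the graph are supported by at most four vertices, whose
    images are affinely independent. *)
Lemma straight_injective : {in graph_space R G &, injective straight}.
Proof.
move=> p q /[!inE] -[p0 p1 [e eS pe]] [q0 q1 [e' eS' qe]] pq.
have simplex (c : {set G}) : c \in simplices G -> exists u w, c = [set u; w]%SET.
  rewrite inE => /orP[/imsetP[[u w] _ ->]|/imsetP[u _ ->]]; first by exists u, w.
  by exists u, u; rewrite finset.setUid.
have [u [w eE]] := simplex _ eS; have [u' [w' eE']] := simplex _ eS'.
have [a [b [c [d [un sub]]]]] := @four_points [:: u; w; u'; w'] isT.
pose r v := p v - q v.
have r_out v : v \notin [:: a; b; c; d] -> r v = 0.
  move=> vN; rewrite /r pe ?qe ?subrr //; apply: contra vN => ve; apply: sub;
    by move: ve; rewrite ?eE ?eE' !inE => /orP[]->; rewrite ?orbT.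
have sum4 (V : zmodType) (F : G -> V) : (forall v, v \notin [:: a; b; c; d] -> F v = 0) ->
    \sum_v F v = F a + F b + F c + F d.
  move=> F0; rewrite (bigID (mem [:: a; b; c; d])) /= [X in _ + X]big1 ?addr0; last first.
    by move=> v /F0.
  by rewrite -big_uniq //= !big_cons big_nil addr0 !addrA.
have r1 : r a + r b + r c + r d = 0.
  by rewrite -sum4 // sumrB p1 q1 subrr.
have r2 : r a *: X a + r b *: X b + r c *: X c + r d *: X d = 0.
  rewrite -(sum4 _ (fun v => r v *: X v)); last by move=> v /r_out->; rewrite scale0r.
  under eq_bigr do rewrite scalerBl; rewrite sumrB.
  by apply/eqP; rewrite subr_eq0; apply/eqP.
have [ra rb rc rd] := affine_independent (genX un) r1 r2.
apply/funext => v; apply/eqP; rewrite -subr_eq0 -/(r v); apply/eqP.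
have [|/r_out//] := boolP (v \in [:: a; b; c; d]).
by rewrite !inE => /or4P[]/eqP->.
Qed.

Lemma straight_tame : tame_embedding straight.
Proof.
split; first split.
- by apply: continuous_subspaceT; apply: straight_continuous.
- exact: straight_injective.
- exists id; last by move=> e /straight_polygonal; rewrite image_id.
  have cid : continuous (@id point) by move=> x; exact: cvg_id.
  by split=> //; exists id.
Qed.

Lemma straight_cycle (s : seq G) x : ucycle (@adj G) s ->
  (straight @` realization R (cycle_edges s)) x ->
  exists2 v, v \in s & segment (X v) (X (next s v)) x.
Proof.
move=> /andP[cs us] [p [p0 p1 [e /imsetP[v vs ->] pe]] <-].
have vn : v != next s v.
  by apply: contraTneq (next_cycle cs vs) => <-; rewrite adj_irrefl.
have : realization R [set [set v; next s v]]%SET p.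
  by split=> //; exists [set v; next s v]%SET => //; rewrite inE.
rewrite realization_edge // => -[t t01 <-]; exists v => //.
by exists t => //; rewrite straight_edge.
Qed.

End StraightLine.

(** * A straight-line embedding with eight split pairs *)

Definition int_det (u v w : seq int) : int :=
  u`_0 * (v`_1 * w`_2 - v`_2 * w`_1) - u`_1 * (v`_0 * w`_2 - v`_2 * w`_0)
  + u`_2 * (v`_0 * w`_1 - v`_1 * w`_0).

Definition int_sub (u v : seq int) : seq int :=
  [:: u`_0 - v`_0; u`_1 - v`_1; u`_2 - v`_2].

Definition int_dot (u v : seq int) : int := u`_0 * v`_0 + u`_1 * v`_1 + u`_2 * v`_2.

(** The data of an ellipsoid: the solid is the set of the points that the affine
    map with columns col0, col1, col2 and value origin at 0 sends to vectors of
    norm less than radius. *)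
Record ellipsoid := Ellipsoid {
  radius : int; col0 : seq int; col1 : seq int; col2 : seq int; origin : seq int }.

Definition int_map (E : ellipsoid) (x : seq int) : seq int :=
  [seq x`_0 * (col0 E)`_i + x`_1 * (col1 E)`_i + x`_2 * (col2 E)`_i + (origin E)`_i
     | i <- [:: 0; 1; 2]%N].

Definition inside_test E x := int_dot (int_map E x) (int_map E x) < radius E ^+ 2.

(** To keep the integers in the computation small, b ^ 2 < a c is not tested
    directly: it follows from - b n < a m and - b m < c n for a positive pair
    (m, n), that is, with m / n between - b / a and - c / b. *)
Definition weights : seq (int * int) :=
  [:: (1, 1); (1, 2); (2, 1); (1, 3); (3, 1); (5, 13); (13, 5); (7, 6); (6, 7)].

Definition outside_test E x y :=
  let a := int_dot (int_map E x) (int_map E x) - radius E ^+ 2 in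
  let b := int_dot (int_map E x) (int_map E y) - radius E ^+ 2 in
  let c := int_dot (int_map E y) (int_map E y) - radius E ^+ 2 in
  [&& 0 < a, 0 < c & (0 <= b) || has (fun mn => (- b * mn.2 < a * mn.1) &&
    (- b * mn.1 < c * mn.2))
    weights].

(** The positions of the vertices: three for each of the large parts, then the
    apex. *)
Definition coords (n : nat) : seq int := nth [::]
  [:: [:: -3; -2; -1]; [:: -2; 4; -1]; [:: 0; 1; 2];
      [:: 4; 0; 0]; [:: 1; 1; -2]; [:: 0; -1; 2]; [:: 3; -2; 8]] n.

Definition K331_index (v : K331) : nat := (3 * tag v + tagged v)%N.

(** The ellipsoid around the corners of the triangle of a and b.  The entry for
    the linked pair a = b = 1 is a dummy. *)
Definition separator (a b : nat) : ellipsoid := nth (Ellipsoid 0 [::] [::] [::] [::])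
  [:: Ellipsoid 5 [:: 1; -1; 0] [:: -2; 2; -1] [:: -1; 0; 0] [:: -3; 5; -4];
      Ellipsoid 6 [:: 9; -2; -1] [:: -13; 5; -1] [:: -6; 2; 0] [:: -7; 4; -2];
      Ellipsoid 4 [:: 2; 0; -1] [:: 0; 2; 0] [:: -1; 0; 1] [:: 2; 3; -2];
      Ellipsoid 5 [:: 2; 0; 0] [:: 3; 1; 1] [:: 1; 1; 0] [:: -10; -4; -2];
      Ellipsoid 0 [::] [::] [::] [::];
      Ellipsoid 4 [:: 5; -3; -3] [:: 1; 0; -1] [:: -2; 2; 1] [:: 5; -7; -3];
      Ellipsoid 5 [:: 1; 1; 0] [:: 0; 1; 0] [:: 0; 0; 1] [:: -4; -2; -4];
      Ellipsoid 5 [:: 3; 0; 0] [:: 1; 3; -1] [:: 0; 1; 0] [:: -3; -3; -3];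
      Ellipsoid 5 [:: 2; 0; 0] [:: 0; 2; 0] [:: -1; 1; 1] [:: 1; -1; -5]] (3 * a + b)%N.

Definition separation_test (a b : 'I_3) : bool :=
  let E := separator a b in
  let P v := coords (K331_index v) in
  [&& int_det (col0 E) (col1 E) (col2 E) != 0, 0 < radius E,
      all (fun v => inside_test E (P v)) (triangle a b) &
      [&& outside_test E (P (vA (a + 1))) (P (vB (b + 1))),
          outside_test E (P (vB (b + 1))) (P (vA (a + 2))),
          outside_test E (P (vA (a + 2))) (P (vB (b + 2))) &
          outside_test E (P (vB (b + 2))) (P (vA (a + 1)))]].

Lemma separation_testP (a b : 'I_3) : (a, b) != (1, 1) -> separation_test a b.
Proof.
case: a => -[|[|[|//]]] pa; case: b => -[|[|[|//]]] pb ne;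
  solve [by vm_compute | by case/eqP: ne; congr pair; apply: val_inj].
Qed.

Lemma coords_generic : all (fun i => all (fun j => all (fun k => all (fun l =>
   uniq [:: i; j; k; l] ==> (int_det (int_sub (coords j) (coords i))
      (int_sub (coords k) (coords i)) (int_sub (coords l) (coords i)) != 0))
   (iota 0 7)) (iota 0 7)) (iota 0 7)) (iota 0 7).
Proof. by vm_compute. Qed.

Section Example. Variable R : realType.
Local Notation point := 'rV[R]_3.

Definition to_point (u : seq int) : point := \row_i (u`_i)%:~R.

Definition K331_point (v : K331) : point := to_point (coords (K331_index v)).

Lemma to_point_vol (x y z w : seq int) :
  vol (to_point x) (to_point y) (to_point z) (to_point w) =
  (int_det (int_sub y x) (int_sub z x) (int_sub w x))%:~R.
Proof.
rewrite /vol /det3 /int_det /int_sub !mxE /= !(rmorphD, rmorphN, rmorphM, mulrNz) //=.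
Qed.

Lemma K331_index_inj : injective K331_index.
Proof.
have small (v : K331) : (tagged v < 3)%N.
  case: v => [[[|[|[|//]]] k] i] /=; last exact: leq_trans (ltn_ord i) _.
    exact: ltn_ord.
  exact: ltn_ord.
move=> u v; rewrite /K331_index => e.
have t : tag u = tag v.
  apply: val_inj; have := congr1 (divn^~ 3) e.
  by rewrite /= ![(3 * _)%N]mulnC !divnMDl // !divn_small ?addn0.
have i : (tagged u = tagged v :> nat).
  by have := congr1 (modn^~ 3) e; rewrite /= ![(3 * _)%N]mulnC !modnMDl !modn_small.
case: u v t i {e} => [ku iu] [kv iv] /= t; subst kv => i.
by congr existT; apply: val_inj.
Qed.

Lemma K331_index_lt v : (K331_index v < 7)%N.
Proof. by case: v => [[[|[|[|//]]] k] [i ltin]]; rewrite /K331_index /=; case: i ltin => [|[|[|]]]. Qed.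

Lemma K331_point_generic u v w z : uniq [:: u; v; w; z] ->
  vol (K331_point u) (K331_point v) (K331_point w) (K331_point z) != 0.
Proof.
move=> un; rewrite to_point_vol intr_eq0.
have mem x : K331_index x \in iota 0 7 by rewrite mem_iota K331_index_lt.
have := coords_generic.
move=> /allP/(_ _ (mem u))/allP/(_ _ (mem v))/allP/(_ _ (mem w))/allP/(_ _ (mem z)).
move/implyP; apply.
by rewrite -[uniq _]/(uniq (map K331_index [:: u; v; w; z])) map_inj_uniq //; apply: K331_index_inj.
Qed.

Lemma K331_card : (4 <= #|K331|)%N.
Proof.
have u : uniq [:: vC; vA 0; vB 0; vA 1].
  by rewrite /= !inE !negb_or ?vAE ?vAB ?vBA.
rewrite -[4%N]/(size [:: vC; vA 0; vB 0; vA 1]) -(card_uniqP u); exact: max_card.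
Qed.

Definition K331_embedding := straight K331_point.

Lemma K331_embedding_tame : tame_embedding K331_embedding.
Proof. exact: straight_tame K331_point_generic K331_card. Qed.

Definition ellipsoid_map (E : ellipsoid) : point -> point :=
  affine_map (to_point (col0 E)) (to_point (col1 E)) (to_point (col2 E)) (to_point (origin E)).

Lemma ellipsoid_map_point E x : ellipsoid_map E (to_point x) = to_point (int_map E x).
Proof.
by apply/rowP; apply: ord3P; rewrite /ellipsoid_map /affine_map !mxE /= !(intrD, intrM).
Qed.

Lemma ellipsoid_map_segment E (x y : point) t :
  ellipsoid_map E ((1 - t) *: x + t *: y) =
  (1 - t) *: ellipsoid_map E x + t *: ellipsoid_map E y.
Proof. by apply/rowP => i; rewrite /ellipsoid_map /affine_map !mxE; ring. Qed.

Lemma dot_point x y : \sum_i to_point x 0 i * to_point y 0 i = (int_dot x y)%:~R.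
Proof.
rewrite !big_ord_recl big_ord0 addr0 addrA !mxE /int_dot !(intrD, intrM) /=.
by [].
Qed.

Lemma sqnorm_point x : sqnorm (to_point x) = (int_dot x x)%:~R.
Proof. by rewrite -dot_point; apply: eq_bigr => i _; rewrite expr2. Qed.

Lemma outside_testP E x y (t : R) : outside_test E x y -> 0 <= t <= 1 ->
  ((radius E)%:~R ^+ 2 : R) <
    sqnorm (ellipsoid_map E ((1 - t) *: to_point x + t *: to_point y)).
Proof.
rewrite /outside_test ellipsoid_map_segment !ellipsoid_map_point.
set a := int_dot _ _ - _; set c := int_dot _ _ - _; set b := int_dot _ _ - _.
move=> /and3P[a0 c0 hb] t01.
have hb' : (0 <= b) || (b ^+ 2 < a * c).
  case/orP: hb => [->//|/hasP[[m n] mn /= /andP[h1 h2]]].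
  have /andP[/= m0 n0] : (0 < (m, n).1) && (0 < (m, n).2).
    by apply: (@allP _ (fun w : int * int => (0 < w.1) && (0 < w.2)) weights).
  case: (leP 0 b) => //= b0; have nb : 0 < - b by rewrite oppr_gt0.
  have := ltr_pM (ltW (mulr_gt0 nb n0)) (ltW (mulr_gt0 nb m0)) h1 h2.
  have -> : - b * n * (- b * m) = b ^+ 2 * (m * n) by ring.
  have -> : a * m * (c * n) = a * c * (m * n) by ring.
  by rewrite ltr_pM2r // mulr_gt0.
have intE (u v : seq int) : (int_dot u v - radius E ^+ 2)%:~R =
    (int_dot u v)%:~R - (radius E)%:~R ^+ 2 :> R.
  by rewrite intrB rmorphXn.
apply: segment_outside => //=; rewrite ?sqnorm_point ?dot_point.
- by rewrite -subr_gt0 -intE ltr0z.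
- by rewrite -subr_gt0 -intE ltr0z.
- by rewrite -!intE ler0z -rmorphXn -intrM ltr_int.
Qed.

Lemma K331_embedding_split a b : (a, b) != (1, 1) ->
  split_link (K331_embedding @` realization R (cycle3 a b))
             (K331_embedding @` realization R (cycle4 a b)).
Proof.
move=> /separation_testP; rewrite /separation_test; set E := separator a b.
move=> /and4P[det0 r0 /allP ins /and4P[out1 out2 out3 out4]].
apply: (@ellipsoid_split R (to_point (col0 E)) (to_point (col1 E)) (to_point (col2 E))
  (to_point (origin E)) (radius E)%:~R); rewrite ?ltr0z // -?/(ellipsoid_map E).
- suff -> : det3 (to_point (col0 E)) (to_point (col1 E)) (to_point (col2 E)) =
      (int_det (col0 E) (col1 E) (col2 E))%:~R by rewrite intr_eq0.
  by rewrite /det3 /int_det !mxE !(rmorphD, rmorphN, rmorphM, mulrNz).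
- move=> x /(straight_cycle (triangle_cycle a b)) [v vT [t t01 <-]].
  rewrite -/(ellipsoid_map E _) ellipsoid_map_segment.
  have in_v w : w \in triangle a b ->
      sqnorm (ellipsoid_map E (K331_point w)) < (radius E)%:~R ^+ 2.
    move=> /ins; rewrite /inside_test /K331_point ellipsoid_map_point sqnorm_point.
    by rewrite -(ltr_int R) rmorphXn.
  apply: segment_inside; [by move: t01; rewrite /= in_itv|exact: in_v|].
  by apply: in_v; rewrite mem_next.
- have [n1 n2 n3 n4] := next4 (andP (quad_cycle a b)).2.
  move=> x /(straight_cycle (quad_cycle a b)) [v vQ [t t01 <-]].
  rewrite -/(ellipsoid_map E _); have {}t01 : 0 <= t <= 1 by move: t01; rewrite /= in_itv.
  move: vQ; rewrite !inE => /or4P[]/eqP->; rewrite /quad ?n1 ?n2 ?n3 ?n4; exact: outside_testP.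
Qed.
End Example.

(** * Disjoint cycles, and the theorem *)

Lemma K331_vertexP (v : K331) :
  [\/ exists i, v = vA i, exists j, v = vB j | v = vC].
Proof.
case: v; apply: ord3P => i.
- by apply: Or31; exists i.
- by apply: Or32; exists i.
- by apply: Or33; rewrite (_ : i = ord0) //; apply: val_inj; case: i => -[].
Qed.

Lemma cycle_card (s : seq K331) : ucycle (@adj K331) s -> (3 <= size s)%N ->
  #|cycle_edges s| = size s.
Proof. by move=> /andP[_ us] s3; apply: card_cycle_edges. Qed.

(** The parts of three pairwise adjacent vertices are distinct, hence they are
    all three parts. *)
Lemma triangle_vertices (s : seq K331) : ucycle (@adj K331) s -> size s = 3%N ->
  exists a b, s =i triangle a b.
Proof.
move=> /andP[cs us] s3; pose parts := map (fun v : K331 => tag v) s.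
have up : uniq parts.
  case: s s3 cs {us} @parts => [|x [|y [|z [|]]]] //= _.
  rewrite /multipartite_adj !inE negb_or !andbT => /and3P[xy yz zx].
  by rewrite xy yz eq_sym zx.
have all_parts k : k \in parts.
  have := uniq_min_size up (s2 := enum 'I_3).
  case=> [i _||_ ->]; rewrite ?mem_enum //.
  by rewrite size_enum_ord /parts size_map s3.
have [va vas ea] := mapP (all_parts 0).
have [vb vbs eb] := mapP (all_parts 1).
have [vc vcs ec] := mapP (all_parts 2).
have [[a va_eq]|[j]|] := K331_vertexP va; [|by move=> e; rewrite e in ea|by move=> e; rewrite e in ea].
have [[i]|[b vb_eq]|] := K331_vertexP vb; [by move=> e; rewrite e in eb| |by move=> e; rewrite e in eb].
have [[i]|[i]|vc_eq] := K331_vertexP vc; [by move=> e; rewrite e in ec|by move=> e; rewrite e in ec|].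
exists a, b => x; have ut : uniq (triangle a b) by case/andP: (triangle_cycle a b).
have sub : {subset triangle a b <= s}.
  by move=> v; rewrite !inE => /or3P[]/eqP->; rewrite -?va_eq -?vb_eq -?vc_eq.
have [] := uniq_min_size ut sub; first by rewrite s3.
by move=> _ ->.
Qed.

(** In a cycle of length three any two vertices are consecutive. *)
Lemma mem3_edges (V : eqType) (s : seq V) u w : uniq s -> size s = 3%N ->
  u \in s -> w \in s -> u != w -> next s u = w \/ next s w = u.
Proof.
case: s => [|x [|y [|z [|]]]] //=; rewrite !inE !negb_or !andbT.
move=> /andP[/andP[xy xz] yz] _.
have [yx zx zy] : [/\ y != x, z != x & z != y] by split; rewrite eq_sym.
by move=> /or3P[]/eqP-> /or3P[]/eqP->; rewrite ?eqxx //= ?(negbTE xy) ?(negbTE xz)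
  ?(negbTE yz) ?(negbTE yx) ?(negbTE zx) ?(negbTE zy) ?eqxx; auto.
Qed.

Lemma eq_triangle_edges (G : sgraph) (s s' : seq G) : uniq s -> uniq s' ->
  size s = 3%N -> s =i s' -> cycle_edges s = cycle_edges s'.
Proof.
move=> us us' s3 ss'; have s'3 : size s' = 3%N.
  by rewrite -s3; apply/perm_size; rewrite perm_sym uniq_perm.
have half (t t' : seq G) : uniq t -> uniq t' -> size t = 3%N -> size t' = 3%N -> t =i t' ->
    cycle_edges t \subset cycle_edges t'.
  move=> ut ut' t3 t'3 tt'; apply/fintype.subsetP => _ /imsetP[x xt ->].
  have nx : next t x \in t' by rewrite -tt' mem_next.
  have xt' : x \in t' by rewrite -tt'.
  have xn : x != next t x.
    have [i r rt] := rot_to xt; rewrite -(next_rot i ut) rt.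
    have : uniq (x :: r) by rewrite -rt rot_uniq.
    have : size (x :: r) = 3%N by rewrite -rt size_rot.
    by case: r {rt} => [|y r] //= _; rewrite !inE eqxx negb_or => /andP[/andP[]].
  case: (mem3_edges ut' t'3 xt' nx xn) => e; apply/imsetP.
    by exists x; rewrite ?e.
  by exists (next t x); rewrite ?e // finset.setUC.
by apply/eqP; rewrite finset.eqEsubset !half // => x; rewrite ss'.
Qed.

Lemma edge_avoiding_triangle a b (u w : K331) : adj u w -> u \notin triangle a b ->
  w \notin triangle a b -> [set u; w]%SET \in cycle4 a b.
Proof.
rewrite !inE !negb_or => auw /and3P[uC ua ub] /and3P[wC wa wb].
case: (K331_vertexP u) (K331_vertexP w) => [[i ui]|[i ui]|ui] [[j wj]|[j wj]|wj];
  move: auw uC ua ub wC wa wb; rewrite ?ui ?wj ?eqxx //.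
- by move=> _ _ ia _ _ _ jb; apply: edgeQ; [move: ia|move: jb]; rewrite ?vAE ?vBE.
- by move=> _ _ _ ib _ ja _; rewrite finset.setUC; apply: edgeQ; [move: ja|move: ib]; rewrite ?vAE ?vBE.
Qed.

(** The edges of the cycle are among the four edges of the quadrilateral.  They
    are at least three, and not three because a triangle contains the apex. *)
Lemma quad_edges a b (s : seq K331) : ucycle (@adj K331) s -> (3 <= size s)%N ->
  (forall x, x \in s -> x \notin triangle a b) -> cycle_edges s = cycle4 a b.
Proof.
move=> cyc s3 avoid; have /andP[cs us] := cyc.
have sub : cycle_edges s \subset cycle4 a b.
  apply/fintype.subsetP => _ /imsetP[x xs ->].
  apply: edge_avoiding_triangle; [exact: next_cycle|exact: avoid|].
  by apply: avoid; rewrite mem_next.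
apply/eqP; rewrite finset.eqEcard sub card_Q (cycle_card cyc s3).
move: s3; rewrite leq_eqVlt => /orP[/eqP s3|//].
have [a' [b' st]] := triangle_vertices cyc (esym s3).
have : vC \in s by rewrite st !inE eqxx.
by move/avoid; rewrite !inE eqxx.
Qed.

Lemma K331_card_le : (#|K331| <= 7)%N.
Proof.
rewrite cardE -(size_map K331_index) -(size_iota 0 7); apply: uniq_leq_size.
  by rewrite map_inj_uniq ?enum_uniq //; apply: K331_index_inj.
by move=> _ /mapP[v _ ->]; rewrite mem_iota K331_index_lt.
Qed.

(** Of two disjoint cycles on seven vertices one is a triangle. *)
Lemma K331_disjoint_cycles C1 C2 : is_cycle C1 -> is_cycle C2 ->
  @vertex_disjoint K331 C1 C2 ->
  exists a b, (C1 = cycle3 a b /\ C2 = cycle4 a b) \/ (C1 = cycle4 a b /\ C2 = cycle3 a b).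
Proof.
move=> [s1 [cyc1 s1_3 ->]] [s2 [cyc2 s2_3 ->]].
rewrite /vertex_disjoint (eq_disjoint (cover_cycle_edges _)).
rewrite disjoint_sym (eq_disjoint (cover_cycle_edges _)) => dis.
have [/andP[_ us1] /andP[_ us2]] := (cyc1, cyc2).
have us : uniq (s1 ++ s2).
  by rewrite cat_uniq us1 us2 andbT -disjoint_has.
have size7 : (size s1 + size s2 <= 7)%N.
  by rewrite -size_cat -(card_uniqP us); apply: leq_trans K331_card_le; apply: max_card.
have TQ s s' : ucycle (@adj K331) s -> ucycle (@adj K331) s' -> size s = 3%N ->
    (3 <= size s')%N -> (forall x, x \in s' -> x \notin s) ->
    exists a b, cycle_edges s = cycle3 a b /\ cycle_edges s' = cycle4 a b.
  move=> cs cs' s3 s'3 ss'; have [a [b st]] := triangle_vertices cs s3.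
  exists a, b; split.
    by apply: eq_triangle_edges => //; case/andP: cs.
  by apply: quad_edges => // x xs'; rewrite -st; apply: ss'.
have [s1_eq|s1_neq] := eqVneq (size s1) 3%N.
  have [a [b [e1 e2]]] := TQ s1 s2 cyc1 cyc2 s1_eq s2_3 (fun x xs => negbT (disjointFr dis xs)).
  by exists a, b; left.
have s2_eq : size s2 = 3%N.
  apply/eqP; rewrite eqn_leq s2_3 andbT -(leq_add2l 4) (leq_trans _ size7) // leq_add2r.
  by rewrite ltn_neqAle eq_sym s1_neq.
have [a [b [e1 e2]]] := TQ s2 s1 cyc2 cyc1 s2_eq s1_3 (fun x xs => negbT (disjointFl dis xs)).
by exists a, b; right.
Qed.

Section Main. Variable R : realType.

Lemma mem_links (f : {ptws K331 -> R} -> 'rV[R]_3) C1 C2 : is_link f C1 C2 ->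
  [set C1; C2]%SET \in links f.
Proof. by move=> l; rewrite inE; apply/asboolP; exists C1, C2. Qed.

(** At most one pair is linked since the others are split, and one is linked
    since this holds for every embedding. *)
Lemma K331_embedding_links :
  links (@K331_embedding R) = [set [set cycle3 1 1; cycle4 1 1]]%SET.
Proof.
have only a b : is_link (@K331_embedding R) (cycle3 a b) (cycle4 a b) \/
    is_link (@K331_embedding R) (cycle4 a b) (cycle3 a b) -> (a, b) = (1, 1).
  move=> l; apply/eqP; apply: contraT => /(K331_embedding_split R) sp.
  case: l => -[_ _ _]; first by move/(_ sp).
  by move/(_ (split_linkC sp)).
have sub : links (@K331_embedding R) \subset [set [set cycle3 1 1; cycle4 1 1]]%SET.
  apply/fintype.subsetP => P; rewrite finset.in_set1 finset.in_set.
  move=> /asboolP [C1 [C2 [-> l]]].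
  have [c1 c2 dis _] := l.
  have [a [b [] [e1 e2]]] := K331_disjoint_cycles c1 c2 dis; subst C1 C2.
    by have [-> ->] := only a b (or_introl l).
  by have [-> ->] := only a b (or_intror l); rewrite finset.setUC.
apply/eqP; rewrite finset.eqEsubset sub finset.sub1set.
have [emb _] := K331_embedding_tame R.
have [a [b l]] := K331_linked emb.
by have [ea eb] := only a b (or_introl l); move: l; rewrite ea eb => /mem_links.
Qed.

End Main.

Local Close Scope ring_scope.
Local Close Scope classical_set_scope.

Theorem proposition4 (R : realType) :
  (forall f : {ptws K331 -> R} -> 'rV[R]_3, tame_embedding f ->
     exists C1 C2 : {set {set K331}},
       [/\ is_link f C1 C2, #|C1| = 3%N & #|C2| = 4%N]) /\
  (exists2 f : {ptws K331 -> R} -> 'rV[R]_3,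
     tame_embedding f & #|links f| = 1%N) /\
  mnl R K331 = 1%N.
Proof.
have one : #|links (@K331_embedding R)| = 1%N.
  by rewrite K331_embedding_links cards1.
have least (f : {ptws K331 -> R} -> 'rV[R]_3) : tame_embedding f -> (1 <= #|links f|)%N.
  move=> [/K331_linked[a [b l]] _]; rewrite card_gt0; apply/set0Pn.
  by exists [set cycle3 a b; cycle4 a b]%SET; apply: mem_links.
split; [|split].
- move=> f [/K331_linked[a [b l]] _]; exists (cycle3 a b), (cycle4 a b).
  by rewrite card_T card_Q.
- by exists (@K331_embedding R); first exact: K331_embedding_tame.
- rewrite /mnl; case: xgetP => [n _ [[f tf <-] le]|no].
    by apply/eqP; rewrite eqn_leq least // -one le //; apply: K331_embedding_tame.
  exfalso; apply: (no 1%N); split=> //.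
  by exists (@K331_embedding R); first exact: K331_embedding_tame.
Qed.
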